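(* Let $m\ge0$ be an integer and $x>0$. Then, for either choice of the sign $\pm$, $$\left.\frac{\partial \mathrm{W}_{\kappa,\mu}(x)}{\partial\kappa}\right|_{\kappa=(1+m)/2,\ \mu=\pm m/2}=e^{-x/2}x^{(1+m)/2}\left\{\ln x-\sum_{k=1}^{m}x^{-k}\left[e^{x}\,\Gamma(k)+\binom{m}{k}\,\gamma(k,-x)\right]\right\}.$$
   Context: For $x>0$, the Whittaker function is $\mathrm{W}_{\kappa,\mu}(x)=e^{-x/2}x^{\mu+1/2}\,\mathrm{U}\left(\frac12+\mu-\kappa,1+2\mu,x\right)$, where $\mathrm{U}$ is the Tricomi confluent hypergeometric function. $\gamma(\nu,z)=\int_0^z t^{\nu-1}e^{-t}\,dt$ is the lower incomplete gamma function. *)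

(* Defs.v *)
From HB Require Import structures.
From mathcomp Require Import all_boot all_order all_algebra.
From mathcomp Require Import all_classical all_reals all_analysis.

Set Implicit Arguments.
Unset Strict Implicit.
Unset Printing Implicit Defensive.

Import Order.TTheory GRing.Theory Num.Theory.
Import numFieldNormedType.Exports.

Local Open Scope classical_set_scope.
Local Open Scope ring_scope.

(* Kummer's equation  z w'' + (b - z) w' - a w = 0  on the half-line z > 0. *)
Definition kummer_solution (R : realType) (a b : R) (w : R -> R) : Prop :=
  forall z : R, 0 < z ->
    [/\ derivable w z 1, derivable (derive1 w) z 1 &
        z * derive1 (derive1 w) z + (b - z) * derive1 w z - a * w z = 0].

(* The standard definition of the Tricomi function (DLMF 13.2.6): U(a, b, -)
   is the solution of Kummer's equation with U(a, b, z) ~ z^(-a) as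
   z -> +oo.  It makes sense for all real a and b, including integer b and
   a <= 0.  The half-line already determines it: every solution
   independent of it grows like e^z z^(a-b). *)
Definition is_tricomiU (R : realType) (a b : R) (w : R -> R) : Prop :=
  kummer_solution a b w /\ w z / z `^ (- a) @[z --> +oo] --> (1 : R).

(* Only meaningful for x > 0. *)
Definition tricomiU (R : realType) (a b x : R) : R :=
  xget 0 [set y | exists w : R -> R, is_tricomiU a b w /\ y = w x].

(* Only meaningful for x > 0. *)
Definition whittakerW (R : realType) (kappa mu x : R) : R :=
  expR (- x / 2) * x `^ (mu + 1 / 2) *
  tricomiU (1 / 2 + mu - kappa) (1 + 2 * mu) x.

(* Euler's integral; only meaningful for s > 0. *)
Definition Gamma (R : realType) (s : R) : R :=
  \int[lebesgue_measure]_(t in `]0, +oo[) (t `^ (s - 1) * expR (- t)).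

(* Oriented integral from 0 to z.  The order k >= 1 is an integer, so that the
   integrand is real for negative t as well. *)
Definition lower_gamma (R : realType) (k : nat) (z : R) : R :=
  if 0 <= z
  then \int[lebesgue_measure]_(t in `[0, z]) (t ^+ k.-1 * expR (- t))
  else - \int[lebesgue_measure]_(t in `[z, 0]) (t ^+ k.-1 * expR (- t)).

(* Main.v *)
Require Import Defs.
From HB Require Import structures.
From mathcomp Require Import all_boot all_order all_algebra.
From mathcomp Require Import all_classical all_reals all_analysis.
From mathcomp Require Import measurable_realfun ring lra.

(* For a > -1 and any real b, the Tricomi function is
     U(a, b, z) = z^-a + a / Gamma(1 + a) * H(a, b, z),
     H(a, b, z) = int_0^oo t^(a-1) ((1+t)^(b-1-a) - 1) e^(-zt) dt.
   Unlike Euler's integral this is regular at a = 0, and it only involves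
   convergent Laplace transforms: differentiating and integrating by parts
   gives Kummer's equation, and H = o(z^-a) gives the asymptotics. Conversely,
   the Wronskian of two solutions equivalent to z^-a is a multiple of e^z z^-b,
   which their asymptotics force to vanish, so the solutions agree near +oo and
   hence everywhere. Since H is continuous in a, dU/da at a = 0 is
   - ln z + H(0, b, z). For b = 1 + m the binomial formula turns H(0, b, z) into
   a sum of the terms 'C(m, k) Gamma(k) z^-k, and the right-hand side of the
   theorem reduces to it through gamma(k, -x) = (k-1)! (1 - e^x E_k(-x)), with
   E_k the truncated exponential series. The sign mu = -m/2 reduces to
   mu = m/2 by Kummer's transformation U(a, b, z) = z^(1-b) U(a-b+1, 2-b, z). *)

Import Order.TTheory GRing.Theory Num.Theory.
Import numFieldNormedType.Exports.

Local Open Scope classical_set_scope.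
Local Open Scope ring_scope.

(** * Differentiation rules for functions written as lambda terms *)

Section pointwise_derivatives.
Context {R : realType}.
Implicit Types (f g : R -> R) (a b c t : R).

Lemma is_derive1_cst c t : is_derive t 1 (fun=> c) 0.
Proof. exact: is_derive_cst. Qed.

Lemma is_derive1_id t : is_derive t 1 (fun x : R => x) 1.
Proof. exact: is_derive_id. Qed.

Lemma is_derive1D f g a b t : is_derive t 1 f a -> is_derive t 1 g b ->
  is_derive t 1 (fun x => f x + g x) (a + b).
Proof. exact: is_deriveD. Qed.

Lemma is_derive1N f a t : is_derive t 1 f a -> is_derive t 1 (fun x => - f x) (- a).
Proof. exact: is_deriveN. Qed.

Lemma is_derive1B f g a b t : is_derive t 1 f a -> is_derive t 1 g b ->
  is_derive t 1 (fun x => f x - g x) (a - b).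
Proof. exact: is_deriveB. Qed.

Lemma is_derive1M f g a b t : is_derive t 1 f a -> is_derive t 1 g b ->
  is_derive t 1 (fun x => f x * g x) (a * g t + f t * b).
Proof.
move=> df dg; have h := @is_deriveM _ _ f g t 1 a b df dg.
by apply: is_derive_eq h _; rewrite /GRing.scale/= addrC (mulrC a).
Qed.

Lemma is_derive1Z c f a t : is_derive t 1 f a ->
  is_derive t 1 (fun x => c * f x) (c * a).
Proof. exact: is_deriveZ. Qed.

Lemma is_derive1X n t : is_derive t 1 (fun x : R => x ^+ n.+1) (n.+1%:R * t ^+ n).
Proof.
elim: n => [|n IHn].
  by apply: is_derive_eq (is_derive1_id t) _; rewrite mulr1.
rewrite (_ : (fun x => _) = fun x : R => x * x ^+ n.+1); last first.
  by apply/funext => x; rewrite exprS.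
apply: is_derive_eq (is_derive1M _ _ _ _ _ (is_derive1_id t) IHn) _.
by rewrite -[n.+2%:R]natr1 exprS; ring.
Qed.

Lemma is_derive1V f a t : f t != 0 -> is_derive t 1 f a ->
  is_derive t 1 (fun x => (f x)^-1) (- a / f t ^+ 2).
Proof.
move=> f0 df; have h := is_deriveV f0 df.
by apply: is_derive_eq h _; rewrite /GRing.scale/= !mulNr (mulrC a).
Qed.

Lemma is_derive1_powR_comp p f a t : 0 < f t -> is_derive t 1 f a ->
  is_derive t 1 (fun x => f x `^ p) (p * f t `^ (p - 1) * a).
Proof.
move=> f0 df.
by have := @is_derive1_comp R (@powR R ^~ p) f t _ _ (is_derive1_powR _ f0) df.
Qed.

Lemma is_derive1_expR_comp f a t : is_derive t 1 f a ->
  is_derive t 1 (fun x => expR (f x)) (expR (f t) * a).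
Proof. by move=> df; exact: (@is_derive1_comp R (@expR R) f). Qed.

Lemma is_derive1_continuous f a t : is_derive t 1 f a -> {for t, continuous f}.
Proof. by move=> [df _]; apply/differentiable_continuous/derivable1_diffP. Qed.

End pointwise_derivatives.

(** * Improper integrals over the open half-line *)

Section improper_integral.
Context {R : realType}.
Implicit Types f F : R -> R.
Let mu := @lebesgue_measure R.
Local Notation Rpos := (`]0%R, +oo[%classic : set R).

(** Compact intervals exhausting the open half-line. The shift by 2 makes the left end smaller than
    the right end already at n = 0. *)
Definition truncation (n : nat) : set R := `[n.+2%:R^-1, n.+2%:R].

Lemma truncation_cvg (f : R -> \bar R) (t : R) : 0 < t ->
  (f \_ (truncation n)) t @[n --> \oo] --> f t.
Proof.
move=> t0; apply: cvg_near_cst.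
near=> n; rewrite patchE mem_set//= /truncation /= in_itv/=; apply/andP; split.
- rewrite -[leRHS]invrK lef_pV2 ?posrE ?invr_gt0//.
  apply/ltW/(@lt_le_trans _ _ n%:R); last by rewrite ler_nat -addn2 leq_addr.
  by near: n; exact: nbhs_infty_gtr.
- apply: (@le_trans _ _ n%:R); last by rewrite ler_nat -addn2 leq_addr.
  by near: n; exact: nbhs_infty_ger.
Unshelve. all: by end_near. Qed.

Lemma truncation_subset n : truncation n `<=` Rpos.
Proof.
move=> t; rewrite /truncation/= !in_itv/= andbT => /andP[h _].
by apply: (lt_le_trans _ h); rewrite invr_gt0.
Qed.

Lemma measurable_truncation n : measurable (truncation n).
Proof. exact: measurable_itv. Qed.

Lemma measurable_fun_half_line f :
  (forall t : R, 0 < t -> {for t, continuous f}) ->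
  measurable_fun Rpos f.
Proof.
move=> cf; apply: open_continuous_measurable_fun => // t.
by rewrite inE/= in_itv/= andbT => /cf.
Qed.

Lemma measurable_fun_truncation f n :
  (forall t : R, 0 < t -> {for t, continuous f}) ->
  measurable_fun Rpos ((EFin \o f) \_ (truncation n)).
Proof.
move=> cf; apply/(measurable_restrict _ _) => //.
  exact: measurable_truncation.
apply: (@measurable_funS _ _ _ _ Rpos) => //.
apply/measurable_EFinP; exact: measurable_fun_half_line.
Qed.

Lemma integral_truncation f F (n : nat) :
  (forall t : R, 0 < t -> {for t, continuous f}) ->
  (forall t : R, 0 < t -> is_derive t 1 F (f t)) ->
  (\int[mu]_(t in Rpos) ((EFin \o f) \_ (truncation n)) t =
   (F n.+2%:R - F n.+2%:R^-1)%:E)%E.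
Proof.
move=> cf dF.
rewrite -integral_mkcondr setIidr; last exact: truncation_subset.
have n2 : (n.+2%:R^-1 < n.+2%:R :> R).
  by apply: (@lt_trans _ _ 1); rewrite ?invf_lt1// ltr1n.
have pos t : n.+2%:R^-1 <= t -> 0 < t.
  by move=> h; apply: (lt_le_trans _ h); rewrite invr_gt0.
have cF t : 0 < t -> {for t, continuous F}.
  by move=> t0; apply/differentiable_continuous/derivable1_diffP; case: (dF t t0).
rewrite /truncation [LHS](@continuous_FTC2 _ f F)//.
- apply: continuous_in_subspaceT => t; rewrite inE/= in_itv/= => /andP[/pos t0 _].
  exact: cf.
- split.
  + by move=> t; rewrite in_itv/= => /andP[/ltW/pos t0 _]; case: (dF t t0).
  + by apply: cvg_at_right_filter; apply: cF; exact: pos.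
  + by apply: cvg_at_left_filter; apply: cF.
- move=> t; rewrite in_itv/= => /andP[/ltW/pos t0 _].
  by rewrite derive1E; apply: derive_val; apply: dF.
Qed.

Lemma cvg_truncation_bounds F (A B : R) :
  F t @[t --> 0^'+] --> A -> F t @[t --> +oo] --> B ->
  F n.+2%:R - F n.+2%:R^-1 @[n --> \oo] --> B - A.
Proof.
move=> FA FB.
have n2 : n.+2%:R @[n --> \oo] --> (+oo : set_system R).
  apply/cvgryPge => r; near=> n; apply: (@le_trans _ _ n%:R); last by rewrite ler_nat -addn2 leq_addr.
  by near: n; exact: nbhs_infty_ger.
apply: cvgB; first by move/cvg_pinftyP : FB; exact.
move/cvg_at_rightP : FA; apply; split; first by move=> n; rewrite invr_gt0.
by apply/gtr0_cvgV0; [exact: nearW|].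
Unshelve. all: by end_near. Qed.

(** Monotone convergence along the truncations identifies the integral with B - A, which is
    finite. *)
Lemma ge0_integrable_FTC f F (A B : R) :
  (forall t : R, 0 < t -> 0 <= f t) ->
  (forall t : R, 0 < t -> {for t, continuous f}) ->
  (forall t : R, 0 < t -> is_derive t 1 F (f t)) ->
  F t @[t --> 0^'+] --> A -> F t @[t --> +oo] --> B ->
  mu.-integrable Rpos (EFin \o f).
Proof.
move=> f0 cf dF FA FB.
have mf : measurable_fun Rpos (EFin \o f).
  apply/measurable_EFinP; exact: measurable_fun_half_line.
apply/integrableP; split => //.
rewrite (_ : (\int[mu]_(t in Rpos) _ = \int[mu]_(t in Rpos) (f t)%:E)%E); last first.
  apply: eq_integral => t; rewrite inE/= in_itv/= andbT => t0.
  by rewrite ger0_norm// f0.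
have lim : (\int[mu]_(t in Rpos) ((EFin \o f) \_ (truncation n)) t @[n --> \oo]
    --> (B - A)%:E)%E.
  under eq_cvg do rewrite (integral_truncation f F)//.
  by apply: cvg_EFin; [exact: nearW|exact: cvg_truncation_bounds].
have lim2 : (\int[mu]_(t in Rpos) ((EFin \o f) \_ (truncation n)) t @[n --> \oo]
    --> \int[mu]_(t in Rpos) (f t)%:E)%E.
  pose g n := (EFin \o f) \_ (truncation n).
  rewrite [X in _ --> X](_ : _ = \int[mu]_(t in Rpos) limn (g ^~ t))%E; last first.
    apply: eq_integral => t; rewrite inE/= in_itv/= andbT => t0.
    by apply/esym/cvg_lim => //; exact: truncation_cvg.
  apply: (@cvg_monotone_convergence _ _ _ mu _ _ g) => //.
  - by move=> n; exact: measurable_fun_truncation.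
  - move=> n t; rewrite /= in_itv/= andbT => t0; rewrite /g patchE; case: ifPn => // _.
    by rewrite lee_fin f0.
  - move=> t; rewrite /= in_itv/= andbT => t0 n m nm; rewrite /g !patchE.
    case: ifPn => [|_]; last by case: ifPn => //; rewrite lee_fin f0.
    rewrite inE/= /truncation /= in_itv/= => /andP[nt tn].
    rewrite mem_set//= in_itv/=; apply/andP; split.
      by apply: le_trans nt; rewrite lef_pV2 ?posrE// ler_nat !ltnS.
    by apply: (le_trans tn); rewrite ler_nat !ltnS.
by rewrite (cvg_unique _ lim2 lim)// ltry.
Qed.

(** For an integrand of any sign, dominated convergence along the truncations, with [|f|] as
    majorant. *)
Lemma Rintegral_FTC f F (A B : R) :
  (forall t : R, 0 < t -> {for t, continuous f}) ->
  mu.-integrable Rpos (EFin \o f) ->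
  (forall t : R, 0 < t -> is_derive t 1 F (f t)) ->
  F t @[t --> 0^'+] --> A -> F t @[t --> +oo] --> B ->
  \int[mu]_(t in Rpos) f t = B - A.
Proof.
move=> cf intf dF FA FB.
have lim : (\int[mu]_(t in Rpos) ((EFin \o f) \_ (truncation n)) t @[n --> \oo]
    --> (B - A)%:E)%E.
  under eq_cvg do rewrite (integral_truncation f F)//.
  by apply: cvg_EFin; [exact: nearW|exact: cvg_truncation_bounds].
have lim2 : (\int[mu]_(t in Rpos) ((EFin \o f) \_ (truncation n)) t @[n --> \oo]
    --> \int[mu]_(t in Rpos) (f t)%:E)%E.
  apply: (@dominated_cvg _ _ _ mu _ _ _ _ (fun t => `|(f t)%:E|)%E) => //.
  - by move=> n; exact: measurable_fun_truncation.
  - by move=> t; rewrite /= in_itv/= andbT => t0; exact: truncation_cvg.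
  - exact: integrable_abse.
  - by move=> n t _; rewrite patchE; case: ifPn => // _; rewrite abse0.
by rewrite /Rintegral (cvg_unique _ lim2 lim).
Qed.

End improper_integral.

(** * Elementary bounds on e^u - 1 and on powers of 1 + t *)

Section exponential_bounds.
Context {R : realType}.
Implicit Types p q e t u z : R.

(** For u >= 0, multiply 1 - u <= e^(-u) by e^u. For u < 0, combine 1 - e^u <= -u with e^(-u) >=
    1. *)
Lemma norm_expR_sub1 u : `|expR u - 1| <= `|u| * expR `|u|.
Proof.
have [u0|u0] := leP 0 u.
  rewrite ger0_norm ?subr_ge0; last by rewrite -expR0 ler_expR.
  rewrite ger0_norm//.
  have := expR_ge1Dx (- u); have := expRxMexpNx_1 u; have := expR_gt0 u.
  move: (expR u) (expR (- u)) => A B A0 AB uB.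
  have : A * (1 - u) <= A * B by rewrite ler_pM2l.
  by lra.
rewrite ler0_norm ?subr_le0; last by rewrite expR_le1 ltW.
rewrite ltr0_norm//.
have := expR_ge1Dx u; have : 1 <= expR (- u) by rewrite -expR0 ler_expR; lra.
move: (expR u) (expR (- u)) => A B B1 uA.
have : - u * 1 <= - u * B by rewrite ler_wpM2l//; lra.
by lra.
Qed.

Lemma powRD1 p t : 0 < t -> t `^ (p + 1) = t * t `^ p.
Proof.
move=> t0; rewrite powRD; last by rewrite (gt_eqF t0) implybT.
by rewrite powRr1 ?ltW// mulrC.
Qed.

(** The inequality ln s < s at s = d (1 + t) bounds ln (1 + t) by an affine function of slope d,
    where |q| d <= e. *)
Lemma powR1D_le q e : 0 < e ->
  exists2 C, 0 <= C & forall t, 0 < t -> (1 + t) `^ q <= C * expR (e * t).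
Proof.
(* Adding 1 to |q| covers the case q = 0. *)
move=> e0; pose d := e / (`|q| + 1).
have q1 : 0 < `|q| + 1 by rewrite ltr_wpDl.
have d0 : 0 < d by rewrite divr_gt0.
have qd : `|q| * d <= e by rewrite /d mulrCA ger_pMr// ler_pdivrMr// mul1r lerDl.
exists (expR (`|q| * (d - ln d))); first exact: expR_ge0.
move=> t t0; rewrite /powR gt_eqF ?addr_gt0// -expRD ler_expR.
have l0 : 0 <= ln (1 + t) by rewrite ln_ge0// lerDl ltW.
apply: (@le_trans _ _ (`|q| * ln (1 + t))); first by rewrite ler_wpM2r// ler_norm.
have : ln (d * (1 + t)) < d * (1 + t) by apply: ln_sublinear; rewrite mulr_gt0// addr_gt0.
rewrite lnM ?posrE ?addr_gt0// => dt.
apply: (@le_trans _ _ (`|q| * (d * (1 + t) - ln d))).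
  by apply: ler_wpM2l => //; lra.
have : `|q| * d * t <= e * t by rewrite ler_wpM2r// ltW.
by lra.
Qed.

(** Take u = q ln (1 + t) in the bound on e^u - 1 and use ln (1 + t) <= t. *)
Lemma norm_powR1D_sub1 q t : 0 < t ->
  `|(1 + t) `^ q - 1| <= `|q| * (t * (1 + t) `^ `|q|).
Proof.
move=> t0; have t1 : 1 + t != 0 by rewrite gt_eqF// addr_gt0.
have l0 : 0 <= ln (1 + t) by rewrite ln_ge0// lerDl ltW.
rewrite /powR (negbTE t1).
apply: (le_trans (norm_expR_sub1 _)); rewrite normrM (ger0_norm l0) mulrA.
rewrite ler_wpM2r ?expR_ge0// ler_wpM2l// le_ln1Dx//.
by apply: (lt_trans _ t0); rewrite oppr_lt0.
Qed.

End exponential_bounds.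

(** * Subexponential functions and the Laplace transform *)

Section laplace.
Context {R : realType}.
Implicit Types (f g h : R -> R) (p q e t z : R).
Let mu := @lebesgue_measure R.
Local Notation Rpos := (`]0%R, +oo[%classic : set R).

(* The weight t^p allows, for p > -1, an integrable singularity at 0. *)
Definition subexponential p f :=
  (forall t : R, 0 < t -> {for t, continuous f}) /\
  (forall e : R, 0 < e -> exists2 C : R, 0 <= C &
     forall t : R, 0 < t -> `|f t| <= C * (t `^ p * expR (e * t))).

Definition laplace f z : R :=
  \int[mu]_(t in Rpos) (f t * expR (- (z * t))).

Lemma near_pos t : 0 < t -> \forall s \near t, 0 < s.
Proof. by move=> t0; exact: lt_nbhsr. Qed.

Lemma eq_subexponential p f g : (forall t : R, 0 < t -> f t = g t) ->
  subexponential p f -> subexponential p g.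
Proof.
move=> fg [cf bf]; split=> [t t0|e /bf[C C0 fC]]; last first.
  by exists C => // t t0; rewrite -fg// fC.
have fgt : {near t, f =1 g}.
  by near=> s; apply: fg; near: s; exact: near_pos.
rewrite /prop_for /continuous_at -(fg _ t0).
apply: cvg_trans (cf _ t0); exact: near_eq_cvg.
Unshelve. all: by end_near. Qed.

Lemma eq_laplace f g z : (forall t : R, 0 < t -> f t = g t) -> laplace f z = laplace g z.
Proof.
move=> fg; apply: eq_Rintegral => t; rewrite inE/= in_itv/= andbT => t0.
by rewrite fg.
Qed.

Lemma continuous_powR p t : 0 < t -> {for t, continuous (@powR R ^~ p)}.
Proof.
move=> t0; apply/differentiable_continuous/derivable1_diffP.
by have [] := @is_derive1_powR R p t t0.
Qed.

Lemma subexponential_powR p : subexponential p (@powR R ^~ p).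
Proof.
split=> [t|e e0]; first exact: continuous_powR.
exists 1 => // t t0; rewrite mul1r ger0_norm ?powR_ge0//.
by rewrite ler_peMr ?powR_ge0// -expR0 ler_expR mulr_ge0// ltW.
Qed.

Lemma continuous_powR1D q t : 0 < t -> {for t, continuous (fun t : R => (1 + t) `^ q)}.
Proof.
move=> t0; apply: (@continuous_comp _ _ _ (fun t => 1 + t) (@powR R ^~ q)).
  by apply: continuousD; [exact: cvg_cst|exact: cvg_id].
by apply: continuous_powR; rewrite addr_gt0.
Qed.

(** The rate e is split in halves: one absorbs the polynomial growth of [g], the other the growth of
    [f]. *)
Lemma subexponentialM p f g : (forall t : R, 0 < t -> {for t, continuous g}) ->
  (exists q C, 0 <= C /\ forall t : R, 0 < t -> `|g t| <= C * (1 + t) `^ q) ->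
  subexponential p f -> subexponential p (fun t => g t * f t).
Proof.
move=> cg [q [D [D0 gD]]] [cf bf]; split=> [t t0|e e0].
  by apply: continuousM; [exact: cg|exact: cf].
have e2 : 0 < e / 2 by rewrite divr_gt0.
have [A A0 fA] := bf _ e2.
have [B B0 qB] := powR1D_le q (e / 2) e2.
exists (D * B * A); first by rewrite !mulr_ge0.
move=> t t0; rewrite normrM.
rewrite [leRHS](_ : _ = (D * (B * expR (e / 2 * t))) * (A * (t `^ p * expR (e / 2 * t)))).
  apply: ler_pM => //; last exact: fA.
  by apply: (le_trans (gD _ t0)); rewrite ler_wpM2l// qB.
rewrite (_ : e * t = e / 2 * t + e / 2 * t); last by field.
by rewrite expRD; ring.
Qed.

Lemma subexponential_powR1DM p q f :
  subexponential p f -> subexponential p (fun t => (1 + t) `^ q * f t).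
Proof.
apply: subexponentialM; first exact: continuous_powR1D.
by exists q, 1; split=> // t _; rewrite mul1r ger0_norm ?powR_ge0.
Qed.

Lemma subexponential_idM p f :
  subexponential p f -> subexponential p (fun t => t * f t).
Proof.
apply: subexponentialM; first by move=> t _; exact: cvg_id.
exists 1, 1; split=> // t t0; rewrite mul1r ger0_norm ?ltW//.
by rewrite powRr1 ?lerDr// ?addr_ge0 ?ltW// ltr_pwDl.
Qed.

Lemma subexponentialZ p c f :
  subexponential p f -> subexponential p (fun t => c * f t).
Proof.
apply: subexponentialM; first by move=> t _; exact: cvg_cst.
by exists 0, `|c|; split=> // t _; rewrite powRr0 mulr1.
Qed.

Lemma subexponentialD p f g : subexponential p f -> subexponential p g ->
  subexponential p (fun t => f t + g t).
Proof.
move=> [cf bf] [cg bg]; split=> [t t0|e e0].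
  by apply: continuousD; [exact: cf|exact: cg].
have [A A0 fA] := bf _ e0; have [B B0 gB] := bg _ e0.
exists (A + B); first exact: addr_ge0.
move=> t t0; apply: (le_trans (ler_normD _ _)).
by rewrite mulrDl lerD// ?fA ?gB.
Qed.

Lemma subexponentialB p f g : subexponential p f -> subexponential p g ->
  subexponential p (fun t => f t - g t).
Proof.
move=> sf sg; apply: (eq_subexponential p (fun t => f t + -1 * g t)).
  by move=> t _; rewrite mulN1r.
by apply: subexponentialD => //; exact: subexponentialZ.
Qed.

Lemma continuous_expRMl z t : {for t, continuous (fun t : R => expR (- (z * t)))}.
Proof.
apply: (@continuous_comp _ _ _ (fun t => - (z * t)) expR); last exact: continuous_expR.
apply: continuousN; apply: continuousM; [exact: cvg_cst|exact: cvg_id].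
Qed.

Lemma integrable_dominated f g :
  (forall t : R, 0 < t -> {for t, continuous f}) ->
  (forall t : R, 0 < t -> `|f t| <= g t) ->
  mu.-integrable Rpos (EFin \o g) -> mu.-integrable Rpos (EFin \o f).
Proof.
move=> cf fg; apply: le_integrable => //.
  by apply/measurable_EFinP; exact: measurable_fun_half_line.
move=> t; rewrite /= in_itv/= andbT => t0; rewrite lee_fin.
by apply: (le_trans (fg _ t0)); exact: ler_norm.
Qed.

Lemma integrableZl_fin f (c : R) : mu.-integrable Rpos (EFin \o f) ->
  mu.-integrable Rpos (EFin \o (fun t => c * f t)).
Proof.
move=> intf; rewrite (_ : EFin \o _ = fun t => (c%:E * (EFin \o f) t)%E).
  exact: integrableZl.
by apply/funext.
Qed.

End laplace.

(** * Integrability and linearity of Laplace transforms *)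

Section laplace_integrable.
Context {R : realType}.
Implicit Types (f g h : R -> R) (p q e t z : R).
Let mu := @lebesgue_measure R.
Local Notation Rpos := (`]0%R, +oo[%classic : set R).

Lemma is_derive_frac t : 0 < t ->
  is_derive t 1 (fun t : R => t / (1 + t)) ((1 + t) ^- 2).
Proof.
move=> t0; have t1 : 1 + t != 0 by rewrite gt_eqF// addr_gt0.
have d1 := is_derive1D _ _ _ _ _ (is_derive1_cst 1 t) (is_derive1_id t).
apply: is_derive_eq (is_derive1M _ _ _ _ _ (is_derive1_id t) (is_derive1V _ _ _ t1 d1)) _.
by field.
Qed.

(* An integrand with an explicit primitive, dominating t^p e^(-zt). *)
Lemma integrable_powR_frac p : -1 < p ->
  mu.-integrable Rpos (EFin \o (fun t => (t / (1 + t)) `^ p * (1 + t) ^- 2)).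
Proof.
move=> p1; have s0 : 0 < p + 1 by rewrite -ltrBlDr sub0r.
have u0 t : 0 < t -> 0 < t / (1 + t) by move=> t0; rewrite divr_gt0// addr_gt0.
have du t : 0 < t -> is_derive t 1 (fun t : R => (p + 1)^-1 * (t / (1 + t)) `^ (p + 1))
    ((t / (1 + t)) `^ p * (1 + t) ^- 2).
  move=> t0.
  have h := is_derive1Z (p + 1)^-1 _ _ _
    (is_derive1_powR_comp (p + 1) (fun t => t / (1 + t)) _ _ (u0 _ t0) (is_derive_frac _ t0)).
  apply: is_derive_eq h _; rewrite addrK.
  by field; rewrite !gt_eqF// addr_gt0.
apply: (ge0_integrable_FTC _ (fun t => (p + 1)^-1 * (t / (1 + t)) `^ (p + 1)) 0 (p + 1)^-1).
- by move=> t t0; rewrite mulr_ge0// ?powR_ge0// invr_ge0 exprn_ge0// addr_ge0// ltW.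
- move=> t t0; apply: continuousM.
    apply: (@continuous_comp _ _ _ (fun t => t / (1 + t)) (@powR R ^~ p)).
      by apply: is_derive1_continuous; exact: is_derive_frac.
    by apply: continuous_powR; exact: u0.
  apply: continuousV; first by rewrite expf_neq0// gt_eqF// addr_gt0.
  apply: (@continuous_comp _ _ _ (fun t => 1 + t) (fun t => t ^+ 2)).
    by apply: continuousD; [exact: cvg_cst|exact: cvg_id].
  exact: exprn_continuous.
- rewrite -[X in _ --> X](mulr0 (p + 1)^-1); apply: cvgMr.
  apply: (@squeeze_cvgr _ _ _ _ (cst 0) (fun t => t `^ (p + 1))).
  + near=> t; have t0 : 0 < t by [].
    rewrite powR_ge0/= ge0_ler_powR// ?ltW// ?nnegrE ?ltW// ?u0//.
    by rewrite ltr_pdivrMr ?addr_gt0// ltr_pMr// ltrDl.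
  + exact: cvg_cst.
  + exact: powR_cvg0.
- rewrite -[X in _ --> X]mulr1; apply: cvgMr.
  have := @continuous_powR R (p + 1) 1 ltr01.
  rewrite /prop_for /continuous_at powR1 => c1.
  suff frac1 : t / (1 + t) @[t --> +oo] --> (1 : R).
    exact: (cvg_comp (fun t => t / (1 + t)) (@powR R ^~ (p + 1)) frac1 c1).
  rewrite -[X in _ --> X]subr0.
  have : 1 - (1 + t)^-1 @[t --> +oo] --> (1 - 0 : R).
    apply: cvgB; first exact: cvg_cst.
    apply/gtr0_cvgV0.
      by near=> t; rewrite addr_gt0//; near: t; exact: nbhs_pinfty_gt.
    apply/cvgryPge => r; near=> t; rewrite -lerBlDl.
    by near: t; apply: nbhs_pinfty_ge; exact: num_real.
  apply: cvg_trans; apply: near_eq_cvg; near=> t.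
  have t1 : 1 + t != 0.
    by rewrite gt_eqF// addr_gt0//; near: t; exact: nbhs_pinfty_gt.
  by field.
Unshelve. all: by end_near. Qed.

(** Write t^p = (t/(1+t))^p (1+t)^p; the bound (1+t)^(p+2) <= C e^(zt) then reduces the claim to the
    explicit integrand above. *)
Lemma integrable_powR_expR p z : -1 < p -> 0 < z ->
  mu.-integrable Rpos (EFin \o (fun t => t `^ p * expR (- (z * t)))).
Proof.
move=> p1 z0; have [C C0 bC] := powR1D_le (p + 2) z z0.
apply: (integrable_dominated _ (fun t => C * ((t / (1 + t)) `^ p * (1 + t) ^- 2))).
- by move=> t t0; apply: continuousM; [exact: continuous_powR|exact: continuous_expRMl].
- move=> t t0; rewrite ger0_norm; last by rewrite mulr_ge0 ?powR_ge0 ?expR_ge0.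
  have t1 : 0 < 1 + t by rewrite addr_gt0.
  have -> : t `^ p = (t / (1 + t)) `^ p * (1 + t) `^ p.
    by rewrite -powRM ?divr_ge0 ?ltW// divfK// gt_eqF.
  rewrite -mulrA [leRHS]mulrCA ler_wpM2l ?powR_ge0//.
  rewrite expRN ler_pdivrMr ?expR_gt0// mulrAC ler_pdivlMr ?exprn_gt0//.
  apply: le_trans (bC _ t0).
  rewrite powRD ?(gt_eqF t1) ?implybT//. by rewrite powR_mulrn// ltW.
- by apply: integrableZl_fin; exact: integrable_powR_frac.
Qed.

Lemma continuous_laplace_integrand p f z t : subexponential p f -> 0 < t ->
  {for t, continuous (fun t : R => f t * expR (- (z * t)))}.
Proof.
by move=> [cf _] t0; apply: continuousM; [exact: cf|exact: continuous_expRMl].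
Qed.

(** Half of the decay e^(-zt) pays for the growth of [f], which leaves t^p e^(-zt/2). *)
Lemma integrable_laplace p f z : -1 < p -> subexponential p f -> 0 < z ->
  mu.-integrable Rpos (EFin \o (fun t => f t * expR (- (z * t)))).
Proof.
move=> p1 sf z0; have z2 : 0 < z / 2 by rewrite divr_gt0.
have [C C0 fC] := sf.2 _ z2.
apply: (integrable_dominated _ (fun t => C * (t `^ p * expR (- (z / 2 * t))))).
- by move=> t; exact: continuous_laplace_integrand sf.
- move=> t t0; rewrite normrM (ger0_norm (expR_ge0 _)).
  rewrite [X in - (X * _)](_ : z = z / 2 - - (z / 2)); last by field.
  apply: (le_trans (ler_wpM2r (expR_ge0 _) (fC _ t0))).
  rewrite -!mulrA -expRD; do 2 (rewrite ler_wpM2l ?powR_ge0//).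
  by rewrite ler_expR; lra.
- by apply: integrableZl_fin; exact: integrable_powR_expR.
Qed.

Lemma laplaceD p f g z : -1 < p -> subexponential p f -> subexponential p g ->
  0 < z -> laplace (fun t => f t + g t) z = laplace f z + laplace g z.
Proof.
move=> p1 sf sg z0; rewrite /laplace.
under eq_Rintegral do rewrite mulrDl.
by rewrite RintegralD//; [exact: integrable_laplace p1 sf z0|exact: integrable_laplace p1 sg z0].
Qed.

Lemma laplaceZ p c f z : -1 < p -> subexponential p f -> 0 < z ->
  laplace (fun t => c * f t) z = c * laplace f z.
Proof.
move=> p1 sf z0; rewrite /laplace.
under eq_Rintegral do rewrite -mulrA.
by rewrite RintegralZl//; exact: integrable_laplace p1 sf z0.
Qed.

Lemma laplaceB p f g z : -1 < p -> subexponential p f -> subexponential p g ->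
  0 < z -> laplace (fun t => f t - g t) z = laplace f z - laplace g z.
Proof.
move=> p1 sf sg z0; rewrite /laplace.
under eq_Rintegral do rewrite mulrBl.
by rewrite RintegralB//; [exact: integrable_laplace p1 sf z0|exact: integrable_laplace p1 sg z0].
Qed.

End laplace_integrable.

(** * Differentiation, integration by parts and decay of Laplace transforms *)

Section laplace_calculus.
Context {R : realType}.
Implicit Types (f g h : R -> R) (p q e t z : R).
Let mu := @lebesgue_measure R.
Local Notation Rpos := (`]0%R, +oo[%classic : set R).

Lemma MVT_gt (l : R) (f df : R -> R) (x y : R) :
  (forall t : R, l < t -> is_derive t 1 f (df t)) -> l < x -> x < y ->
  exists2 c : R, x < c < y & f y - f x = df c * (y - x).
Proof.
move=> fdf lx xy.
have fd t : t \in `]x, y[ -> is_derive t 1 f (df t).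
  by rewrite in_itv/= => /andP[xt _]; apply: fdf; exact: lt_trans xt.
have cf : {within `[x, y], continuous f}.
  apply: derivable_within_continuous => t; rewrite in_itv/= => /andP[xt _].
  by have [] := fdf _ (lt_le_trans lx xt).
by have [c cxy ->] := MVT xy fd cf; exists c => //; move: cxy; rewrite in_itv.
Qed.

(** Differentiation under the integral for parameters in ]z/2, 2z[, where C t^p e^(zt/4) e^(-zt/2)
    is an integrable bound that does not depend on the parameter. *)
Lemma is_derive_laplace p f z : -1 < p -> subexponential p f -> 0 < z ->
  is_derive z 1 (laplace f) (- laplace (fun t => t * f t) z).
Proof.
move=> p1 sf z0; pose F (x t : R) := f t * expR (- (x * t)).
have dF (x t : R) : is_derive x 1 (F ^~ t) (- (t * f t * expR (- (x * t)))).
  have dx := is_derive1N _ _ _ (is_derive1M _ _ _ _ _ (is_derive1_id x) (is_derive1_cst t x)).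
  apply: is_derive_eq (is_derive1Z (f t) _ _ _ (is_derive1_expR_comp _ _ _ dx)) _.
  by ring.
have d1F (x t : R) : partial1of2 F x t = - (t * f t * expR (- (x * t))).
  by rewrite partial1of2E; exact: derive_val.
have z4 : 0 < z / 4 by rewrite divr_gt0.
have [C C0 fC] := (subexponential_idM _ _ sf).2 _ z4.
pose G (t : R) := C * (t `^ p * expR (- (z / 4 * t))).
have G0 t : 0 <= G t by rewrite mulr_ge0// mulr_ge0 ?powR_ge0 ?expR_ge0.
have intG : mu.-integrable Rpos (EFin \o G).
  by apply: integrableZl_fin; exact: integrable_powR_expR.
have xz (x : R) : (`](z / 2), (2 * z)[%classic : set R) x -> z / 2 < x /\ 0 < x.
  rewrite /= in_itv/= => /andP[zx _]; split=> //.
  by apply: lt_trans zx; rewrite divr_gt0.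
have zI : (`](z / 2), (2 * z)[%classic : set R) z.
  by rewrite /= in_itv/=; apply/andP; split; lra.
have mR : measurable Rpos by exact: measurable_itv.
have intF (x : R) : (`](z / 2), (2 * z)[%classic : set R) x ->
    mu.-integrable Rpos (EFin \o F x).
  by move=> /xz[_ x0]; exact: integrable_laplace p1 sf x0.
have derF (x t : R) : (`](z / 2), (2 * z)[%classic : set R) x -> Rpos t ->
    derivable (F ^~ t) x 1 by move=> _ _; have [] := dF x t.
have GF (x t : R) : (`](z / 2), (2 * z)[%classic : set R) x -> Rpos t ->
    `|partial1of2 F x t| <= G t.
  move=> /xz[zx _]; rewrite /= in_itv/= andbT => t0.
  rewrite d1F normrN normrM (ger0_norm (expR_ge0 _)).
  apply: (le_trans (ler_wpM2r (expR_ge0 _) (fC _ t0))).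
  rewrite /G -!mulrA -expRD; do 2 (rewrite ler_wpM2l ?powR_ge0//).
  rewrite ler_expR.
  have : z / 2 * t <= x * t by rewrite ler_wpM2r// ltW.
  by lra.
apply: DeriveDef.
  exact: (@derivable_under_integral R _ _ (@lebesgue_measure R) F Rpos mR z _ _ zI intF derF G G0 intG GF).
rewrite -derive1E.
rewrite (@differentiation_under_integral R _ _ (@lebesgue_measure R) F Rpos mR z _ _ zI intF derF G G0 intG GF).
transitivity (laplace (fun t => -1 * (t * f t)) z).
  by apply: eq_Rintegral => t _; rewrite d1F mulN1r mulNr.
rewrite (laplaceZ p)//; first by rewrite mulN1r.
exact: subexponential_idM.
Qed.

(** For t >= 1 both the exponential factor and t^p cost at most e^(zt/4) up to constants, so a decay
    e^(-zt/2) remains. *)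
Lemma cvg_subexponential p h z : subexponential p h -> 0 < z ->
  h t * expR (- (z * t)) @[t --> +oo] --> 0.
Proof.
move=> sh z0; have z4 : 0 < z / 4 by rewrite divr_gt0.
have [C C0 hC] := sh.2 _ z4; have [D D0 pD] := powR1D_le `|p| _ z4.
apply: norm_cvg0.
have dom : C * D * expR (- (z / 2 * t)) @[t --> +oo] --> 0.
  rewrite -[X in _ --> X](mulr0 (C * D)); apply: cvgMr.
  apply: (cvg_comp (fun t => z / 2 * t) (fun t => expR (- t))); last exact: cvgr_expR.
  by apply: gt0_cvgMry; [rewrite divr_gt0|exact: cvg_id].
apply: (@squeeze_cvgr _ _ _ _ (cst 0) _ _ _ _ _ dom); last exact: cvg_cst.
near=> t; have t1 : 1 <= t by near: t; apply: nbhs_pinfty_ge; exact: num_real.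
have t0 : 0 < t by exact: lt_le_trans t1.
rewrite normr_ge0/= normrM (ger0_norm (expR_ge0 _)).
have -> : expR (- (z / 2 * t)) = expR (z / 4 * t) * expR (z / 4 * t) * expR (- (z * t)).
  by rewrite -!expRD; congr expR; field.
rewrite !mulrA ler_wpM2r ?expR_ge0//.
apply: (le_trans (hC _ t0)).
rewrite mulrA ler_wpM2r ?expR_ge0// -mulrA ler_wpM2l//.
apply: le_trans (pD _ t0); apply: (@le_trans _ _ (t `^ `|p|)).
  by rewrite ler_powR// ler_norm.
by rewrite ge0_ler_powR// ?nnegrE ?addr_ge0// ?ltW// ltrDr.
Unshelve. all: by end_near. Qed.

(** Integrate the derivative of h(t) e^(-zt): the boundary term vanishes at 0 by hypothesis and at
    infinity by subexponential growth. *)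
Lemma laplace_parts p h dh z : -1 < p -> 0 < z ->
  subexponential p h -> subexponential p dh ->
  (forall t : R, 0 < t -> is_derive t 1 h (dh t)) ->
  h t @[t --> 0^'+] --> 0 ->
  laplace dh z = z * laplace h z.
Proof.
move=> p1 z0 sh sdh dhE h0.
have szh := subexponentialZ p z h sh.
apply/eqP; rewrite -subr_eq0 -(laplaceZ p)// -(laplaceB p)//; apply/eqP.
have dexp t : is_derive t 1 (fun t : R => expR (- (z * t))) (- z * expR (- (z * t))).
  have h1 := is_derive1N _ _ _ (is_derive1Z z _ _ _ (is_derive1_id t)).
  by apply: is_derive_eq (is_derive1_expR_comp _ _ _ h1) _; ring.
have dF t : 0 < t -> is_derive t 1 (fun t : R => h t * expR (- (z * t)))
    ((dh t - z * h t) * expR (- (z * t))).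
  move=> t0; apply: is_derive_eq (is_derive1M _ _ _ _ _ (dhE _ t0) (dexp t)) _.
  by ring.
rewrite -[RHS](subr0 0).
apply: (Rintegral_FTC _ (fun t => h t * expR (- (z * t)))).
- move=> t t0; exact: continuous_laplace_integrand (subexponentialB _ _ _ sdh szh) t0.
- exact: integrable_laplace p1 (subexponentialB _ _ _ sdh szh) z0.
- rewrite -[X in _ --> X](mul0r (expR (- (z * 0)))); apply: cvgM => //.
  by apply: cvg_at_right_filter; exact: continuous_expRMl.
- exact: cvg_subexponential sh z0.
Qed.

(** The functional equation of Gamma with a parameter z, by parts on t^(p+1), which tends to 0 at 0
    because p > -1. *)
Lemma laplace_powRD1 p z : -1 < p -> 0 < z ->
  z * laplace (@powR R ^~ (p + 1)) z = (p + 1) * laplace (@powR R ^~ p) z.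
Proof.
move=> p1 z0; have sp := subexponential_powR p.
rewrite -(laplaceZ p _ _ _ p1 sp z0); apply/esym.
apply: (laplace_parts p) => //.
- apply: eq_subexponential (subexponential_idM _ _ sp) => t t0.
  by rewrite powRD1.
- exact: subexponentialZ.
- move=> t t0; apply: is_derive_eq (is_derive1_powR _ t0) _.
  by rewrite addrK.
- by apply: powR_cvg0; rewrite -ltrBlDr sub0r.
Qed.

(** By the functional equation, z^(p+1) times the transform has derivative zero, hence keeps its
    value at z = 1. *)
Lemma laplace_powR p z : -1 < p -> 0 < z ->
  laplace (@powR R ^~ p) z = z `^ (- (p + 1)) * laplace (@powR R ^~ p) 1.
Proof.
move=> p1 z0; have sp := subexponential_powR p.
pose g x := x `^ (p + 1) * laplace (@powR R ^~ p) x.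
have dg (x : R) : 0 < x -> is_derive x 1 g 0.
  move=> x0.
  apply: is_derive_eq (is_derive1M _ _ _ _ _ (is_derive1_powR _ x0)
    (is_derive_laplace _ _ _ p1 sp x0)) _.
  rewrite (eq_laplace (fun t => t * t `^ p) (@powR R ^~ (p + 1))); last first.
    by move=> t t0; rewrite powRD1.
  by rewrite powRD1// addrK mulrAC -laplace_powRD1//; ring.
have gz : g z = g 1.
  apply/eqP; rewrite -subr_eq0; apply/eqP.
  have [z1|z1|->] := ltgtP z 1; last by rewrite subrr.
  - have [c _ e] := MVT_gt 0 g (fun=> 0) z 1 dg z0 z1.
    by rewrite -opprB e mul0r oppr0.
  - by have [c _ ->] := MVT_gt 0 g (fun=> 0) 1 z dg ltr01 z1; rewrite mul0r.
move: gz; rewrite /g powR1 mul1r => <-.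
by rewrite mulrA powRN mulVf ?mul1r// gt_eqF// powR_gt0.
Qed.

(** From |f(t)| <= C t^p e^t the transform is at most C Gamma(p+1) (z-1)^(-p-1). Since z/(z-1) <= 2
    for z >= 2, the product is O(1/(z-1)). *)
Lemma cvg_powRM_laplace p f : -1 < p -> subexponential p f ->
  z `^ p * laplace f z @[z --> +oo] --> 0.
Proof.
move=> p1 sf; have [C C0 fC] := sf.2 _ ltr01.
pose M := C * (2 `^ `|p| * laplace (@powR R ^~ p) 1).
have dom : M * (z - 1)^-1 @[z --> +oo] --> 0.
  rewrite -[X in _ --> X](mulr0 M); apply: cvgMr; apply/gtr0_cvgV0.
    by near=> t; rewrite subr_gt0; near: t; apply: nbhs_pinfty_gt; exact: num_real.
  apply/cvgryPge => r; near=> t; rewrite lerBrDr.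
  by near: t; apply: nbhs_pinfty_ge; exact: num_real.
apply: norm_cvg0.
apply: (@squeeze_cvgr _ _ _ _ (cst 0) _ _ _ _ _ dom); last exact: cvg_cst.
near=> z; have z2 : 2 <= z by near: z; apply: nbhs_pinfty_ge; exact: num_real.
have z0 : 0 < z by exact: lt_le_trans z2.
have z1 : 0 < z - 1 by lra.
rewrite normr_ge0/= normrM (ger0_norm (powR_ge0 _ _)).
have le1 : `|laplace f z| <= C * laplace (@powR R ^~ p) (z - 1).
  rewrite -(laplaceZ p)//; last exact: subexponential_powR.
  apply: le_trans; first apply: le_normr_Rintegral => //.
    exact: integrable_laplace p1 sf z0.
  apply: le_Rintegral => //.
  - by apply: integrable_norm; exact: integrable_laplace p1 sf z0.
  - exact: integrable_laplace p1 (subexponentialZ _ _ _ (subexponential_powR _)) z1.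
  move=> t; rewrite /= in_itv/= andbT => t0.
  rewrite normrM (ger0_norm (expR_ge0 _)).
  apply: (le_trans (ler_wpM2r (expR_ge0 _) (fC _ t0))).
  rewrite -!mulrA -expRD; do 2 (rewrite ler_wpM2l ?powR_ge0//).
  by rewrite ler_expR; lra.
apply: (le_trans (ler_wpM2l (powR_ge0 _ _) le1)).
rewrite laplace_powR// /M.
have G0 : 0 <= laplace (@powR R ^~ p) 1.
  apply: Rintegral_ge0 => t; rewrite /= in_itv/= andbT => t0.
  by rewrite mulr_ge0 ?powR_ge0 ?expR_ge0.
rewrite [leLHS](_ : _ = C * (z `^ p * (z - 1) `^ (- (p + 1))) * laplace (@powR R ^~ p) 1);
  last by ring.
rewrite [leRHS](_ : _ = C * (2 `^ `|p| / (z - 1)) * laplace (@powR R ^~ p) 1); last by ring.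
rewrite ler_wpM2r// ler_wpM2l//.
have -> : (z - 1) `^ (- (p + 1)) = (z - 1) `^ (- p) * (z - 1)^-1.
  by rewrite opprD powRD ?(gt_eqF z1) ?implybT// powR_inv1// ltW.
rewrite mulrA ler_wpM2r ?invr_ge0 ?(ltW z1)//.
have -> : z `^ p * (z - 1) `^ (- p) = (z / (z - 1)) `^ p.
  rewrite powRN -{1}(divfK (lt0r_neq0 z1) z) powRM ?divr_ge0 ?ltW//.
  by rewrite mulfK// gt_eqF// powR_gt0.
apply: (@le_trans _ _ ((z / (z - 1)) `^ `|p|)).
  apply: ler_powR; last exact: ler_norm.
  by rewrite ler_pdivlMr//; lra.
rewrite ge0_ler_powR// ?nnegrE ?divr_ge0 ?(ltW z0) ?(ltW z1)//.
by rewrite ler_pdivrMr//; lra.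
Unshelve. all: by end_near. Qed.

End laplace_calculus.

(** * The explicit formula solves Kummer's equation with the right asymptotics *)

Section tricomi_solution.
Context {R : realType}.
Implicit Types (a b t z q : R).

Definition tricomi_remainder a b : R -> R :=
  laplace (fun t => t `^ (a - 1) * ((1 + t) `^ (b - 1 - a) - 1)).

(** The denominator [laplace (@powR R ^~ a) 1] is Gamma(1 + a), and [tricomi_remainder] is H. *)
Definition tricomi_formula a b z : R :=
  z `^ (- a) + a / laplace (@powR R ^~ a) 1 * tricomi_remainder a b z.

(** Since (1+t)^q - 1 is O(t) at 0, the weight improves from t^(a-1) to t^a, which is integrable at
    0 for a > -1. *)
Lemma subexponential_remainder a q :
  subexponential a (fun t => t `^ (a - 1) * ((1 + t) `^ q - 1)).
Proof.
have c1 t : 0 < t -> {for t, continuous (fun t : R => (1 + t) `^ q - 1)}.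
  move=> t0; apply: continuousB; last exact: cvg_cst.
  exact: continuous_powR1D.
apply: (eq_subexponential a (fun t => ((1 + t) `^ q - 1) / t * t `^ a)) => [t t0|].
  by rewrite -{1}(subrK 1 a) powRD1// mulrA divfK ?gt_eqF// mulrC.
apply: subexponentialM; last exact: subexponential_powR.
  move=> t t0; apply: continuousM; first exact: c1.
  by apply: continuousV; [rewrite gt_eqF|exact: cvg_id].
exists `|q|, `|q|; split=> // t t0.
rewrite normrM normfV (gtr0_norm t0) ler_pdivrMr//.
by apply: (le_trans (norm_powR1D_sub1 _ _ t0)); rewrite -mulrA (mulrC t).
Qed.

(** Up to the factor -a / Gamma(1 + a), the function whose Laplace transform is the z-derivative of
    [tricomi_formula]. *)
Let k a b t := (1 + t) `^ (b - 1 - a) * t `^ a.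

Let subexponential_k a b : subexponential a (k a b).
Proof. by apply: subexponential_powR1DM; exact: subexponential_powR. Qed.

(** Multiplying the integrand of H by t gives k(t) - t^a, and the transform Gamma(1+a) z^(-a-1) of
    t^a cancels the derivative of z^(-a). *)
Lemma is_derive_tricomi_formula a b z : -1 < a ->
  laplace (@powR R ^~ a) 1 != 0 -> 0 < z ->
  is_derive z 1 (tricomi_formula a b)
    (- (a / laplace (@powR R ^~ a) 1) * laplace (k a b) z).
Proof.
move=> a1 G0 z0.
have dH := is_derive_laplace _ _ _ a1 (subexponential_remainder a (b - 1 - a)) z0.
apply: is_derive_eq (is_derive1D _ _ _ _ _ (is_derive1_powR (- a) z0)
  (is_derive1Z (a / laplace (@powR R ^~ a) 1) _ _ _ dH)) _.
have -> : laplace (fun t => t * (t `^ (a - 1) * ((1 + t) `^ (b - 1 - a) - 1))) z =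
    laplace (k a b) z - laplace (@powR R ^~ a) z.
  rewrite -(laplaceB a)//; last exact: subexponential_powR.
  apply: eq_laplace => t t0; rewrite mulrA -powRD1// subrK mulrBr mulr1.
  by rewrite /k mulrC.
rewrite (laplace_powR a z)// (_ : - a - 1 = - (a + 1)); last by rewrite opprD.
by field.
Qed.

(** Integration by parts for h(t) = (1+t) k(t) - t^a, whose derivative is a times the integrand of H
    plus b k(t). Subtracting t^a makes h vanish at 0 even when a <= 0. *)
Lemma laplace_tricomi a b z : -1 < a -> 0 < z ->
  a * tricomi_remainder a b z + b * laplace (k a b) z =
  z * (laplace (k a b) z + laplace (fun t => t * k a b t) z) -
  z `^ (- a) * laplace (@powR R ^~ a) 1.
Proof.
move=> a1 z0.
have sk := subexponential_k a b.
have sr := subexponential_remainder a (b - 1 - a).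
have sp := subexponential_powR a.
have skk := subexponentialD _ _ _ sk (subexponential_idM _ _ sk).
transitivity (z * laplace (fun t => k a b t + t * k a b t - t `^ a) z); last first.
  rewrite (laplaceB a)// (laplaceD a)//; last exact: subexponential_idM.
  rewrite (laplace_powR a z)// mulrBr mulrA; congr (_ - _ * _).
  rewrite -powRD1//; congr powR; ring.
rewrite /tricomi_remainder -(laplaceZ a a)// -(laplaceZ a b)// -(laplaceD a)//; [|exact: subexponentialZ..].
apply: (laplace_parts a) => //.
- exact: subexponentialB.
- by apply: subexponentialD; exact: subexponentialZ.
- move=> t t0; have t1 : 0 < 1 + t by rewrite addr_gt0.
  have d1 := is_derive1D _ _ _ _ _ (is_derive1_cst 1 t) (is_derive1_id t).
  have dk := is_derive1M _ _ _ _ _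
    (is_derive1_powR_comp (b - 1 - a) (fun t => 1 + t) _ _ t1 d1) (is_derive1_powR a t0).
  apply: is_derive_eq (is_derive1B _ _ _ _ _ (is_derive1D _ _ _ _ _ dk
    (is_derive1M _ _ _ _ _ (is_derive1_id t) dk)) (is_derive1_powR a t0)) _.
  rewrite /k -[in t `^ a](subrK 1 a) -[in (1 + t) `^ (b - 1 - a)](subrK 1 (b - 1 - a)).
  rewrite !powRD1//; ring.
(* Near 0, h(t) = t^a ((1+t)^(b-a) - 1) is O(t^(a+1)). *)
- apply: (@cvg_trans _ (t `^ a * ((1 + t) `^ (b - a) - 1) @[t --> 0^'+])).
    apply: near_eq_cvg; near=> t.
    have t0 : 0 < t by [].
    have -> : b - a = b - 1 - a + 1 by ring.
    by rewrite powRD1 ?addr_gt0// /k; ring.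
  apply: norm_cvg0.
  have dom : `|b - a| * (t `^ (a + 1) * (1 + t) `^ `|b - a|) @[t --> 0^'+] --> 0.
    rewrite -[X in _ --> X](mulr0 `|b - a|); apply: cvgMr.
    rewrite -[X in _ --> X](mul0r ((1 + 0) `^ `|b - a|)); apply: cvgM.
      by apply: powR_cvg0; rewrite -ltrBlDr sub0r.
    apply: cvg_at_right_filter.
    apply: (@continuous_comp _ _ _ (fun t => 1 + t) (@powR R ^~ `|b - a|)).
      by apply: continuousD; [exact: cvg_cst|exact: cvg_id].
    by apply: continuous_powR; rewrite addr0.
  apply: (@squeeze_cvgr _ _ _ _ (cst 0) _ _ _ _ _ dom); last exact: cvg_cst.
  near=> t; have t0 : 0 < t by [].
  rewrite normr_ge0/= normrM ger0_norm ?powR_ge0//.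
  apply: (le_trans (ler_wpM2l (powR_ge0 _ _) (norm_powR1D_sub1 _ _ t0))).
  by rewrite powRD1// le_eqVlt; apply/orP; left; apply/eqP; ring.
Unshelve. all: by end_near. Qed.

(** The first two derivatives are -(a/G) and a/G times the transforms of k and t k, so Kummer's
    expression is a multiple of the identity of [laplace_tricomi]. The asymptotics follow from z^a H
    -> 0. The condition on Gamma(1+a) is supplied near a = 0 by continuity. *)
Lemma is_tricomiU_formula a b : -1 < a -> laplace (@powR R ^~ a) 1 != 0 ->
  is_tricomiU a b (tricomi_formula a b).
Proof.
move=> a1 G0; have sk := subexponential_k a b.
set G := laplace (@powR R ^~ a) 1 in G0 *.
have d1 z : 0 < z -> is_derive z 1 (tricomi_formula a b) (- (a / G) * laplace (k a b) z).
  exact: is_derive_tricomi_formula.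
have d1E z : 0 < z -> derive1 (tricomi_formula a b) z = - (a / G) * laplace (k a b) z.
  by move=> /d1 d; rewrite derive1E; exact: derive_val.
have d2 z : 0 < z -> is_derive z 1 (derive1 (tricomi_formula a b))
    (a / G * laplace (fun t => t * k a b t) z).
  move=> z0.
  have d := is_derive1Z (- (a / G)) _ _ _ (is_derive_laplace _ _ _ a1 sk z0).
  apply: is_derive_eq (near_eq_is_derive _ d) _; last by rewrite mulrNN.
  by near=> x; rewrite d1E//; near: x; exact: near_pos.
split=> [z z0|].
  have := laplace_tricomi a b z a1 z0; rewrite -/G => e.
  split; [by have [] := d1 z z0|by have [] := d2 z z0|].
  rewrite [derive1 (derive1 _) z]derive1E (@derive_val _ _ _ _ _ _ _ (d2 z z0)) d1E//.
  rewrite /tricomi_formula -/G.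
  transitivity (a / G * (z * (laplace (k a b) z + laplace (fun t => t * k a b t) z)
     - z `^ (- a) * G - (a * tricomi_remainder a b z + b * laplace (k a b) z))).
    by field.
  by rewrite -e subrr mulr0.
have lim : 1 + a / G * (z `^ a * tricomi_remainder a b z) @[z --> +oo] --> (1 : R).
  rewrite -[X in _ --> X]addr0 -[X in _ --> _ + X](mulr0 (a / G)).
  apply: cvgD; first exact: cvg_cst.
  by apply: cvgMr; apply: cvg_powRM_laplace => //; exact: subexponential_remainder.
apply: cvg_trans lim; apply: near_eq_cvg; near=> z.
have z0 : 0 < z by near: z; apply: nbhs_pinfty_gt; exact: num_real.
have za : z `^ a != 0 by rewrite gt_eqF// powR_gt0.
by rewrite /tricomi_formula -/G powRN; field; rewrite za G0.
Unshelve. all: by end_near. Qed.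

End tricomi_solution.

(** * Uniqueness of the Tricomi function on the half-line *)

Section tricomi_unique.
Context {R : realType}.
Implicit Types (a b t z : R) (w : R -> R).

Lemma kummer_is_derive a b w z : kummer_solution a b w -> 0 < z ->
  is_derive z 1 w (derive1 w z) /\ is_derive z 1 (derive1 w) (derive1 (derive1 w) z).
Proof.
move=> kw z0; have [d1 d2 _] := kw _ z0.
by split; [apply: (DeriveDef d1)|apply: (DeriveDef d2)]; rewrite derive1E.
Qed.

Lemma kummer_second_derivative a b w z : kummer_solution a b w -> 0 < z ->
  derive1 (derive1 w) z = a / z * w z - (b / z - 1) * derive1 w z.
Proof.
move=> kw z0; have [_ _] := kw _ z0.
move: (w z) (derive1 w z) (derive1 (derive1 w) z) => u u' u'' e.
apply: (mulfI (lt0r_neq0 z0)).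
transitivity (z * u'' - (z * u'' + (b - z) * u' - a * u)); first by rewrite e subr0.
by field; rewrite gt_eqF.
Qed.

(* The differential inequality E' >= - C E for E = u^2 + v^2 when u' = v and
   v' = A u - (B - 1) v, where A = a / z and B = b / z in Kummer's equation. *)
Lemma energy_growth_ge0 (u v A B A' B' : R) : `|A| <= A' -> `|B| <= B' ->
  0 <= 2 * (u * v) + 2 * (v * (A * u - (B - 1) * v)) +
       (1 + A' + 2 * (B' + 1)) * (u * u + v * v).
Proof.
rewrite !ler_norml => /andP[A1 A2] /andP[B1 B2].
have uu : 0 <= u * u by rewrite -expr2 sqr_ge0.
have vv : 0 <= v * v by rewrite -expr2 sqr_ge0.
(* Half of the sum of [sp] and [sm] is 2 (1 + A) u v + (1 + A') (u^2 + v^2), which accounts for the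
   cross term. *)
have sp : 0 <= (2 + A' + A) * ((u + v) * (u + v)).
  by rewrite mulr_ge0 -?expr2 ?sqr_ge0//; lra.
have sm : 0 <= (A' - A) * ((u - v) * (u - v)).
  by rewrite mulr_ge0 -?expr2 ?sqr_ge0//; lra.
have h2 : 0 <= (B' - B) * (v * v) by apply: mulr_ge0 => //; lra.
have h3 : 0 <= (B' + 1) * (u * u) by apply: mulr_ge0 => //; lra.
have h4 : 0 <= (B' + 1) * (v * v) by apply: mulr_ge0 => //; lra.
by lra.
Qed.

Let wronskian w1 w2 z := w1 z * derive1 w2 z - derive1 w1 z * w2 z.

(** Kummer's equation gives W' = (1 - b/z) W, so W z^b e^(-z) has derivative zero. *)
Lemma kummer_wronskian a b w1 w2 : kummer_solution a b w1 -> kummer_solution a b w2 ->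
  exists c : R, forall z : R, 0 < z -> wronskian w1 w2 z * z `^ b = c * expR z.
Proof.
move=> k1 k2; pose g z := wronskian w1 w2 z * (z `^ b * expR (- z)).
have dg z : 0 < z -> is_derive z 1 g 0.
  move=> z0; have [d1 d1'] := kummer_is_derive _ _ _ _ k1 z0.
  have [d2 d2'] := kummer_is_derive _ _ _ _ k2 z0.
  have [_ _ e1] := k1 _ z0; have [_ _ e2] := k2 _ z0.
  have dexp := is_derive1_expR_comp _ _ _ (is_derive1N _ _ _ (is_derive1_id z)).
  apply: is_derive_eq (is_derive1M _ _ _ _ _
    (is_derive1B _ _ _ _ _ (is_derive1M _ _ _ _ _ d1 d2') (is_derive1M _ _ _ _ _ d1' d2))
    (is_derive1M _ _ _ _ _ (is_derive1_powR b z0) dexp)) _.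
  rewrite -[in z `^ b](subrK 1 b) powRD1//.
  move: e1 e2; set p := z `^ _; set q := expR _.
  move: (w1 z) (w2 z) (derive1 w1 z) (derive1 w2 z) (derive1 (derive1 w1) z)
    (derive1 (derive1 w2) z) => u v u' v' u'' v'' e1 e2.
  transitivity (p * q * (u * (z * v'' + (b - z) * v' - a * v) -
     v * (z * u'' + (b - z) * u' - a * u))); first by ring.
  by rewrite e1 e2; ring.
exists (g 1) => z z0.
have gz : g z = g 1.
  apply/eqP; rewrite -subr_eq0; apply/eqP.
  have [z1|z1|->] := ltgtP z 1; last by rewrite subrr.
  - have [c _ e] := MVT_gt 0 g (fun=> 0) z 1 dg z0 z1.
    by rewrite -opprB e mul0r oppr0.
  - by have [c _ ->] := MVT_gt 0 g (fun=> 0) 1 z dg ltr01 z1; rewrite mul0r.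
by rewrite -gz /g expRN; field; rewrite gt_eqF ?expR_gt0.
Qed.

(* Backward Gronwall: ((w1 - w2)^2 + (w1' - w2')^2) e^(Ct) is nondecreasing on
   [x, +oo[ and vanishes at y + 1. *)
Lemma kummer_eq a b w1 w2 y x : kummer_solution a b w1 -> kummer_solution a b w2 ->
  0 < x -> x < y -> (forall z : R, y <= z -> w1 z = w2 z) -> w1 x = w2 x.
Proof.
(* At [Y], beyond y, the solutions agree in a whole neighbourhood, so their derivatives agree
   too. *)
move=> k1 k2 x0 xy w12; pose Y := y + 1.
have xY : x < Y by rewrite /Y; lra.
have Y0 : 0 < Y by exact: lt_trans xY.
(* The constant of [energy_growth_ge0], with |a/s| and |b/s| bounded by their values at x for all s
   >= x. *)
pose C := 1 + `|a| / x + 2 * (`|b| / x + 1).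
pose d t := w1 t - w2 t; pose d' t := derive1 w1 t - derive1 w2 t.
have dY : d Y = 0 by rewrite /d w12 ?subrr// /Y; lra.
have d'Y : d' Y = 0.
  apply/eqP; rewrite /d' subr_eq0; apply/eqP; rewrite !derive1E; apply: near_eq_derive.
  near=> t; apply: w12; apply/ltW; near: t; apply: lt_nbhsr; rewrite /Y; lra.
pose dg t := expR (C * t) * (2 * (d t * d' t) +
  2 * (d' t * (derive1 (derive1 w1) t - derive1 (derive1 w2) t)) +
  C * (d t * d t + d' t * d' t)).
pose g t := (d t * d t + d' t * d' t) * expR (C * t).
have dgE t : 0 < t -> is_derive t 1 g (dg t).
  move=> t0; have [d1 d1'] := kummer_is_derive _ _ _ _ k1 t0.
  have [d2 d2'] := kummer_is_derive _ _ _ _ k2 t0.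
  have dd := is_derive1B _ _ _ _ _ d1 d2; have dd' := is_derive1B _ _ _ _ _ d1' d2'.
  apply: is_derive_eq (is_derive1M _ _ _ _ _
    (is_derive1D _ _ _ _ _ (is_derive1M _ _ _ _ _ dd dd) (is_derive1M _ _ _ _ _ dd' dd'))
    (is_derive1_expR_comp _ _ _ (is_derive1Z C _ _ _ (is_derive1_id t)))) _.
  rewrite /dg /d /d'; move: (C) (expR _) (w1 t) (w2 t) (derive1 w1 t) (derive1 w2 t)
    (derive1 (derive1 w1) t) (derive1 (derive1 w2) t) => K q u1 u2 v1 v2 s1 s2.
  by clear; ring.
have [s /andP[xs _] e] := MVT_gt 0 g dg x Y dgE x0 xY.
have s0 : 0 < s by exact: lt_trans xs.
have dg0 : 0 <= dg s.
  rewrite /dg mulr_ge0 ?expR_ge0//.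
  have -> : derive1 (derive1 w1) s - derive1 (derive1 w2) s =
      a / s * d s - (b / s - 1) * d' s.
    rewrite !(kummer_second_derivative a b)// /d /d'.
    move: (a / s) (b / s) (w1 s) (w2 s) (derive1 w1 s) (derive1 w2 s) => A B u1 u2 v1 v2.
    by clear; ring.
  have bound c : `|c / s| <= `|c| / x.
    rewrite normrM normfV (gtr0_norm s0) ler_wpM2l// lef_pV2 ?posrE//.
    exact: ltW.
  exact: energy_growth_ge0.
have gY : g Y = 0 by rewrite /g dY d'Y !mul0r addr0 mul0r.
have gx : g x <= 0.
  have := mulr_ge0 dg0 (_ : 0 <= Y - x); rewrite -e gY sub0r oppr_ge0; apply.
  by rewrite subr_ge0 ltW.
move: gx; rewrite /g pmulr_lle0 ?expR_gt0// => dx.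
have : d x ^+ 2 = 0.
  apply/eqP; rewrite eq_le sqr_ge0 andbT expr2.
  by apply: le_trans dx; rewrite lerDl -expr2 sqr_ge0.
by move/eqP; rewrite sqrf_eq0 subr_eq0 => /eqP.
Unshelve. all: by end_near. Qed.

(** The ratio r = w2/w1 tends to 1 and has derivative W / w1^2 with W = c e^z z^(-b). If c were
    nonzero, this derivative would stay at least 1 in absolute value near infinity. So c = 0, r is
    constantly 1 near infinity, and backward uniqueness reaches x. *)
Lemma is_tricomiU_unique a b w1 w2 x : is_tricomiU a b w1 -> is_tricomiU a b w2 ->
  0 < x -> w1 x = w2 x.
Proof.
move=> [k1 l1] [k2 l2] x0.
have [c cW] := kummer_wronskian _ _ _ _ k1 k2.
have dens : z `^ (b - a * 2) * expR (- (1 * z)) @[z --> +oo] --> 0.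
  by apply: cvg_subexponential => //; exact: subexponential_powR.
have [Y [Y1 Yw]] : exists Y : R, 1 <= Y /\ forall z : R, Y <= z ->
    [/\ 0 < w1 z, w1 z <= 2 * z `^ (- a) &
        c != 0 -> z `^ (b - a * 2) * expR (- z) <= `|c| / 4].
  have P1 : \forall z \near +oo, 0 < w1 z / z `^ (- a) <= 2.
    have l12 : (1 / 2 : R) < 1 by lra.
    have l12' : 1 < (2 : R) by lra.
    near=> z; apply/andP; split; last by apply/ltW; near: z; exact: (cvgr_lt _ l1).
    apply: (@lt_trans _ _ (1 / 2)); first by lra.
    by near: z; exact: (cvgr_gt _ l1).
  have P2 : \forall z \near +oo, c != 0 -> z `^ (b - a * 2) * expR (- z) <= `|c| / 4.
    have [->|c0] := eqVneq c 0; first by near=> z.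
    have c4 : 0 < `|c| / 4 by rewrite divr_gt0// normr_gt0.
    by near=> z => _; apply/ltW; rewrite -[in - z](mul1r z); near: z; exact: (cvgr_lt _ dens).
  have [Y1 [_ H1]] := P1; have [Y2 [_ H2]] := P2.
  exists (`|Y1| + `|Y2| + 1); split; first by rewrite lerDr addr_ge0.
  move=> z Yz.
  have z1 : Y1 < z by have := ler_norm Y1; have := normr_ge0 Y2; lra.
  have z2 : Y2 < z by have := ler_norm Y2; have := normr_ge0 Y1; lra.
  have z0 : 0 < z by have := normr_ge0 Y2; have := normr_ge0 Y1; lra.
  have /andP[] := H1 _ z1; have pz := powR_gt0 (- a) z0.
  rewrite pmulr_lgt0 ?invr_gt0// ler_pdivrMr// => w0 w2'; split => //; exact: H2.
have Y0 : 0 < Y by exact: lt_le_trans Y1.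
pose r z := w2 z / w1 z.
have dr z : Y < z -> is_derive z 1 r (wronskian w1 w2 z / w1 z ^+ 2).
  move=> Yz; have z0 : 0 < z by exact: lt_trans Yz.
  have [w10 _ _] := Yw _ (ltW Yz).
  have [d1 _] := kummer_is_derive _ _ _ _ k1 z0.
  have [d2 _] := kummer_is_derive _ _ _ _ k2 z0.
  apply: is_derive_eq (is_derive1M _ _ _ _ _ d2 (is_derive1V _ _ _ (lt0r_neq0 w10) d1)) _.
  by rewrite /wronskian; field; rewrite gt_eqF.
have r1 : r z @[z --> +oo] --> (1 : R).
  have : (w2 z / z `^ (- a)) / (w1 z / z `^ (- a)) @[z --> +oo] --> (1 / 1 : R).
    by apply: cvgM => //; apply: cvgV => //; rewrite oner_neq0.
  rewrite divr1; apply: cvg_trans; apply: near_eq_cvg; near=> z.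
  have z0 : 0 < z by near: z; apply: nbhs_pinfty_gt; exact: num_real.
  have [w10 _ _] : [/\ 0 < w1 z, w1 z <= 2 * z `^ (- a) &
        c != 0 -> z `^ (b - a * 2) * expR (- z) <= `|c| / 4].
    by apply: Yw; near: z; apply: nbhs_pinfty_ge; exact: num_real.
  have pz := powR_gt0 (- a) z0.
  by rewrite /r; field; rewrite !gt_eqF.
have W0 z : 0 < z -> wronskian w1 w2 z = c * expR z * z `^ (- b).
  move=> z0; rewrite -cW// powRN mulfK// gt_eqF// powR_gt0//.
have c0 : c = 0.
  apply/eqP/negPn/negP => cn0.
  (* Here w1^2 <= 4 z^(-2a), and the choice of Y makes this at most |c| e^z z^(-b) = |W|. *)
  have big z : Y < z -> 1 <= `|wronskian w1 w2 z / w1 z ^+ 2|.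
    move=> Yz; have z0 : 0 < z by exact: lt_trans Yz.
    have [w10 w12 /(_ cn0) ez] := Yw _ (ltW Yz).
    rewrite W0// normrM normfV (ger0_norm (exprn_ge0 2 (ltW w10))) ler_pdivlMr ?exprn_gt0// mul1r.
    rewrite !normrM (ger0_norm (expR_ge0 _)) (ger0_norm (powR_ge0 _ _)).
    apply: (@le_trans _ _ ((2 * z `^ (- a)) ^+ 2)).
      by rewrite ler_pXn2r// nnegrE ?mulr_ge0 ?powR_ge0 ?ltW.
    have pb := powR_gt0 (- b) z0.
    have e4 := ler_wpM2r (ltW (mulr_gt0 (expR_gt0 z) pb)) ez.
    have -> : (2 * z `^ (- a)) ^+ 2 =
        4 * (z `^ (b - a * 2) * expR (- z) * (expR z * z `^ (- b))).
      have -> : z `^ (b - a * 2) = z `^ b * z `^ (- a) * z `^ (- a).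
        rewrite -!powRD ?(gt_eqF z0) ?implybT//; congr powR; ring.
      rewrite expRN (powRN _ b); field.
      by rewrite !gt_eqF ?expR_gt0 ?powR_gt0.
    by lra.
  have near2 : \forall z \near +oo, `|1 - r z| < 1 / 2.
    have half : 0 < 1 / 2 :> R by lra.
    by move/cvgrPdist_lt : r1; exact.
  have [Z [_ HZ]] := near2.
  (* By the mean value theorem r moves by at least 1 from z to z + 1, although both values lie
     within 1/2 of the limit 1. *)
  pose z := `|Z| + Y + 1.
  have Yz : Y < z by rewrite /z; have := normr_ge0 Z; lra.
  have Zz : Z < z by rewrite /z; have := ler_norm Z; lra.
  have zz1 : z < z + 1 by lra.
  have [s /andP[zs _] e] := MVT_gt Y r _ z (z + 1) dr Yz zz1.
  have := big s (lt_trans Yz zs).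
  have := HZ _ Zz; have := HZ _ (lt_trans Zz zz1).
  have : `|r (z + 1) - r z| <= `|1 - r (z + 1)| + `|1 - r z|.
    rewrite (_ : _ - _ = - (1 - r (z + 1)) + (1 - r z)); last by ring.
    by rewrite (le_trans (ler_normD _ _))// normrN.
  rewrite e (_ : z + 1 - z = 1); last by ring.
  by rewrite mulr1; lra.
have rcst z : Y < z -> r z = r (Y + 1).
  have dr0 t : Y < t -> is_derive t 1 r 0.
    move=> Yt; apply: is_derive_eq (dr _ Yt) _.
    by rewrite W0 ?c0 ?mul0r//; exact: lt_trans Yt.
  move=> Yz; have Y1' : Y < Y + 1 by lra.
  apply/eqP; rewrite -subr_eq0; apply/eqP.
  have [zY|zY|->] := ltgtP z (Y + 1); last by rewrite subrr.
  - have [s _ e] := MVT_gt Y r (fun=> 0) z (Y + 1) dr0 Yz zY.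
    by rewrite -opprB e mul0r oppr0.
  - by have [s _ ->] := MVT_gt Y r (fun=> 0) (Y + 1) z dr0 Y1' zY; rewrite mul0r.
have rY : r (Y + 1) = 1.
  apply: (cvg_unique _ _ r1) => //.
  apply: cvg_near_cst; near=> z; apply: rcst.
  by near: z; apply: nbhs_pinfty_gt; exact: num_real.
(* The point Y + x + 1 lies beyond both x and Y. *)
apply: (kummer_eq _ _ _ _ (Y + x + 1) _ k1 k2 x0); first by lra.
move=> z Yz; have Yz' : Y < z by lra.
have [w10 _ _] := Yw _ (ltW Yz').
have := rcst _ Yz'; rewrite rY /r => /(congr1 ( *%R^~ (w1 z))).
by rewrite divfK ?gt_eqF// mul1r => ->.
Unshelve. all: by end_near. Qed.

End tricomi_unique.

(** * Derivative of the formula with respect to a at a = 0 *)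

Section order_derivative.
Context {R : realType}.
Implicit Types (a b t x : R).
Let mu := @lebesgue_measure R.
Local Notation Rpos := (`]0%R, +oo[%classic : set R).

Lemma laplace_powR0 : laplace (@powR R ^~ 0) 1 = 1.
Proof.
have dF t : 0 < t -> is_derive t 1 (fun t : R => - expR (- (1 * t)))
    (t `^ 0 * expR (- (1 * t))).
  move=> t0; have d1 := is_derive1N _ _ _ (is_derive1Z 1 _ _ _ (is_derive1_id t)).
  apply: is_derive_eq (is_derive1N _ _ _ (is_derive1_expR_comp _ _ _ d1)) _.
  by rewrite powRr0; ring.
have sp := @subexponential_powR R 0.
transitivity (0 - (- 1) : R); last by rewrite sub0r opprK.
apply: (Rintegral_FTC _ (fun t => - expR (- (1 * t)))).
- by move=> t t0; exact: continuous_laplace_integrand sp t0.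
- by apply: (integrable_laplace 0) => //; lra.
- have -> : (-1 : R) = - expR (- (1 * 0)) by rewrite mulr0 oppr0 expR0.
  by apply: cvg_at_right_filter; apply: cvgN; exact: continuous_expRMl.
- rewrite -[X in _ --> X]oppr0; apply: cvgN.
  under eq_cvg do rewrite mul1r.
  exact: cvgr_expR.
Qed.

(** One majorant for all exponents: t^a is at most t^(-1/2) for t <= 1 and at most t^(1/2) for t >
    1. *)
Lemma powR_dominated a t : - (1 / 2) <= a <= 1 / 2 -> 0 < t ->
  t `^ a <= (1 + t) * t `^ (- (1 / 2)).
Proof.
move=> /andP[a1 a2] t0; have p0 := powR_gt0 (- (1 / 2)) t0.
have [t1|t1] := leP t 1.
  apply: (@le_trans _ _ (t `^ (- (1 / 2)))).
    by apply: ger_powR => //; rewrite t0.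
  by rewrite ler_peMl ?(ltW p0)// lerDl ltW.
apply: (@le_trans _ _ (t `^ (- (1 / 2) + 1))).
  by apply: ler_powR; [exact: ltW|lra].
by rewrite powRD1// ler_wpM2r ?(ltW p0)// lerDr.
Qed.

Lemma continuous_powR_exponent t (f : R -> R) a : {for a, continuous f} ->
  0 < t -> {for a, continuous (fun a => t `^ f a)}.
Proof.
move=> cf t0.
have -> : (fun a => t `^ f a) = (fun a => expR (f a * ln t)).
  by apply/funext => u; rewrite /powR gt_eqF.
apply: (@continuous_comp _ _ _ (fun a => f a * ln t) expR); last exact: continuous_expR.
by apply: continuousM => //; exact: cvg_cst.
Qed.

(** Any radius below 1 keeps the exponents a of [I] away from -1. *)
Let I : set R := `](- (1 / 2)), (1 / 2)[.

Lemma continuous_laplace (f : R -> R -> R) (g : R -> R) x : 0 < x ->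
  (forall a, I a -> exists2 p : R, -1 < p & subexponential p (f a)) ->
  (forall a t, 0 < t -> {for a, continuous (f ^~ t)}) ->
  (exists2 p : R, -1 < p & subexponential p g) ->
  (forall a t, I a -> 0 < t -> `|f a t| <= g t) ->
  {for 0, continuous (fun a => laplace (f a) x)}.
Proof.
move=> x0 sf cf [q q1 sg] fg.
have I0 : (0 : R) \in I by rewrite /I inE/= in_itv/=; apply/andP; split; lra.
have mR : measurable Rpos by exact: measurable_itv.
have intf a : I a -> mu.-integrable Rpos (EFin \o (fun t => f a t * expR (- (x * t)))).
  by move=> /sf[p p1 sp]; exact: integrable_laplace p1 sp x0.
have cfe : {ae mu, forall t, Rpos t ->
    {in I, continuous (fun a => f a t * expR (- (x * t)))}}.
  apply/aeW => t; rewrite /= in_itv/= andbT => t0 a _.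
  have c : {for a, continuous (fun a => f a t * expR (- (x * t)))}.
    by apply: continuousM; [exact: cf|exact: cvg_cst].
  exact: c.
have intg := integrable_laplace _ _ _ q1 sg x0.
have fge a : I a -> {ae mu, forall t, Rpos t ->
    `|f a t * expR (- (x * t))| <= g t * expR (- (x * t))}.
  move=> aI; apply/aeW => t; rewrite /= in_itv/= andbT => t0.
  by rewrite normrM (ger0_norm (expR_ge0 _)) ler_wpM2r ?expR_ge0// fg.
exact: (@continuity_under_integral R _ _ (@lebesgue_measure R)
  (fun a t => f a t * expR (- (x * t))) Rpos mR _ _ intf cfe _ intg fge 0 I0).
Qed.

Lemma continuous_Gamma1D x : 0 < x ->
  {for 0, continuous (fun a => laplace (@powR R ^~ a) x)}.
Proof.
move=> x0; apply: (continuous_laplace _ (fun t => (1 + t) * t `^ (- (1 / 2)))) => //.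
- move=> a; rewrite /I/= in_itv/= => /andP[a1 _]; exists a; first lra.
  exact: subexponential_powR.
- by move=> a t t0; apply: continuous_powR_exponent => //; exact: cvg_id.
- exists (- (1 / 2)); first lra.
  have sp := @subexponential_powR R (- (1 / 2)).
  apply: eq_subexponential (subexponentialD _ _ _ sp (subexponential_idM _ _ sp)) => t _.
  by rewrite mulrDl (mul1r (t `^ _)).
- move=> a t; rewrite /I/= in_itv/= => /andP[a1 a2] t0.
  by rewrite ger0_norm ?powR_ge0// powR_dominated// !ltW.
Qed.

(** For a in [I] the exponent q = b - 1 - a satisfies |q| <= |b| + 2, so the bound on (1+t)^q - 1
    and the common majorant of t^a give one dominating function. *)
Lemma continuous_tricomi_remainder b x : 0 < x ->
  {for 0, continuous (fun a => tricomi_remainder a b x)}.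
Proof.
move=> x0; pose g t := (1 + t) `^ (`|b| + 3) * t `^ (- (1 / 2)).
apply: (continuous_laplace _ (fun t => (`|b| + 2) * g t)) => //.
- move=> a; rewrite /I/= in_itv/= => /andP[a1 _]; exists a; first lra.
  exact: subexponential_remainder.
- move=> a t t0; apply: continuousM.
    apply: continuous_powR_exponent => //; apply: continuousB; [exact: cvg_id|exact: cvg_cst].
  apply: continuousB; last exact: cvg_cst.
  apply: continuous_powR_exponent; last by rewrite addr_gt0.
  by apply: continuousB; [exact: cvg_cst|exact: cvg_id].
- exists (- (1 / 2)); first lra.
  by apply: subexponentialZ; apply: subexponential_powR1DM; exact: subexponential_powR.
- move=> a t; rewrite /I/= in_itv/= => /andP[a1 a2] t0.
  have t1 : 0 < 1 + t by rewrite addr_gt0.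
  set q := b - 1 - a.
  have qb : `|q| <= `|b| + 2.
    rewrite ler_norml /q; have := ler_norm b; have := ler_norm (- b).
    by rewrite normrN => ? ?; apply/andP; split; lra.
  rewrite normrM ger0_norm ?powR_ge0//.
  apply: (le_trans (ler_wpM2l (powR_ge0 _ _) (norm_powR1D_sub1 q _ t0))).
  rewrite [leLHS](_ : _ = `|q| * ((1 + t) `^ `|q| * t `^ a)); last first.
    by rewrite -{2}(subrK 1 a) powRD1//; ring.
  apply: ler_pM => //; first by rewrite mulr_ge0 ?powR_ge0.
  rewrite /g (_ : `|b| + 3 = `|b| + 2 + 1); last by ring.
  rewrite powRD1// [leRHS](_ : _ = (1 + t) `^ (`|b| + 2) * ((1 + t) * t `^ (- (1 / 2))));
    last by ring.
  apply: ler_pM; rewrite ?powR_ge0//.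
    by apply: ler_powR => //; rewrite lerDl ltW.
  by rewrite powR_dominated// !ltW.
Qed.

Lemma Gamma1D_neq0_near : \forall a \near (0 : R), laplace (@powR R ^~ a) 1 != 0.
Proof.
have c := continuous_Gamma1D 1 ltr01.
near=> a; apply: lt0r_neq0; near: a.
by apply: (cvgr_gt _ c); rewrite laplace_powR0.
Unshelve. all: by end_near. Qed.

(** The second summand is a times a function of a continuous at 0, so by Caratheodory's criterion
    its derivative at 0 is the value of that function, with Gamma(1) = 1. *)
Lemma is_derive_tricomi_order b x : 0 < x ->
  is_derive (0 : R) (1 : R) (fun a => tricomi_formula a b x)
    (- ln x + tricomi_remainder 0 b x).
Proof.
move=> x0.
have dpow : is_derive (0 : R) (1 : R) (fun a => x `^ (- a)) (- ln x).
  have -> : (fun a => x `^ (- a)) = (fun a => expR (- (ln x * a))).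
    by apply/funext => u; rewrite /powR gt_eqF// mulNr mulrC.
  have d := is_derive1_expR_comp _ _ _ (is_derive1N _ _ _ (is_derive1Z (ln x) _ _ _ (is_derive1_id 0))).
  by apply: is_derive_eq d _; rewrite mulr0 oppr0 expR0 mulr1 mul1r.
apply: is_derive1D => //.
apply/is_derive1_caratheodory.
exists (fun a => (laplace (@powR R ^~ a) 1)^-1 * tricomi_remainder a b x); split.
- by move=> a; rewrite !mul0r !subr0; ring.
- apply: continuousM; last exact: continuous_tricomi_remainder.
  apply: continuousV; first by rewrite laplace_powR0 oner_neq0.
  exact: continuous_Gamma1D.
- by rewrite laplace_powR0 invr1 mul1r.
Qed.

End order_derivative.

(** * Truncated exponential series and a binomial identity *)

Section exponential_sums.
Context {F : numFieldType}.
Implicit Types (x y : F) (m n : nat).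

Definition exp_sum n x : F := \sum_(j < n) x ^+ j / j`!%:R.

Lemma exp_sumS n x : exp_sum n.+1 x = exp_sum n x + x ^+ n / n`!%:R.
Proof. by rewrite /exp_sum big_ord_recr. Qed.

Let fact_neq0 n : n`!%:R != 0 :> F.
Proof. by rewrite pnatr_eq0 -lt0n fact_gt0. Qed.

(** This is the coefficient of T^m in e^(yT) e^(-yT) / (1 - T). In the induction the top terms of
    the truncated sums add up to (y - y)^(m+1) / (m+1)! = 0, and the rest is the case m. *)
Lemma exp_sum_convolution m y :
  \sum_(i < m.+1) y ^+ (m - i) / (m - i)`!%:R * exp_sum i.+1 (- y) = 1.
Proof.
elim: m => [|m IHm].
  by rewrite big_ord_recl big_ord0 /exp_sum big_ord_recl big_ord0 !expr0 !addr0 !divr1 mulr1.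
under eq_bigr do rewrite exp_sumS mulrDr.
rewrite big_split/= [X in X + _](_ : _ = 1); last first.
  rewrite big_ord_recl /exp_sum big_ord0 mulr0 add0r -[RHS]IHm.
  by apply: eq_bigr => i _; rewrite lift0 subSS.
rewrite [X in 1 + X](_ : _ = (y - y) ^+ m.+1 / m.+1`!%:R); last first.
  rewrite exprDn mulr_suml; apply: eq_bigr => i _.
  have im : (i <= m.+1)%N by rewrite -ltnS.
  rewrite -(bin_fact im) !natrM -mulr_natr.
  have bn : 'C(m.+1, i)%:R != 0 :> F by rewrite pnatr_eq0 -lt0n bin_gt0.
  by field; rewrite bn !fact_neq0.
by rewrite subrr expr0n mul0r addr0.
Qed.

(** Induction on m by Pascal's rule: since C(m,i) i! = m!/(m-i)!, the increment is m! x^(-m-1) times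
    the convolution above, which equals 1. *)
Lemma binomial_exp_sum m x : x != 0 ->
  \sum_(i < m) 'C(m, i.+1)%:R * i`!%:R * x ^- i.+1 * exp_sum i.+1 (- x) =
  \sum_(i < m) i`!%:R * x ^- i.+1.
Proof.
move=> x0; elim: m => [|m IHm]; first by rewrite !big_ord0.
rewrite [RHS]big_ord_recr/= -IHm.
under eq_bigr do rewrite binS natrD !mulrDl.
rewrite big_split/= big_ord_recr/= bin_small// !mul0r addr0; congr (_ + _).
transitivity (m`!%:R * x ^- m.+1 *
    \sum_(i < m.+1) x ^+ (m - i) / (m - i)`!%:R * exp_sum i.+1 (- x)); last first.
  by rewrite exp_sum_convolution mulr1.
rewrite mulr_sumr; apply: eq_bigr => i _.
have im : (i <= m)%N by rewrite -ltnS.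
rewrite -(bin_fact im) !natrM.
have -> : x ^- m.+1 = x ^- i.+1 * x ^- (m - i).
  by rewrite -invfM -exprD addSn subnKC.
by field; rewrite !expf_neq0 ?fact_neq0.
Qed.

End exponential_sums.

(** * Gamma, the incomplete gamma function and H(0, 1 + m, x) in closed form *)

Section incomplete_gamma.
Context {R : realType}.
Implicit Types (t x : R) (m n : nat).

Lemma laplace_powR_nat n : laplace (@powR R ^~ n%:R) 1 = n`!%:R.
Proof.
elim: n => [|n IHn]; first by rewrite laplace_powR0.
have n1 : -1 < n%:R :> R by rewrite (lt_le_trans (ltrN10 _)).
have := laplace_powRD1 _ _ n1 ltr01.
by rewrite mul1r natr1 IHn -natrM factS.
Qed.

Lemma GammaS n : Gamma n.+1%:R = n`!%:R :> R.
Proof.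
rewrite -laplace_powR_nat /Gamma /laplace.
by under eq_Rintegral do rewrite -natr1 addrK -[X in expR (- X)]mul1r.
Qed.

Lemma is_derive_exp_sum n t :
  is_derive t 1 (exp_sum n.+1) (exp_sum n t).
Proof.
elim: n => [|n IHn].
  have -> : exp_sum 1 = (fun=> 1 : R).
    by apply/funext => u; rewrite /exp_sum big_ord_recl big_ord0 expr0 divr1 addr0.
  by rewrite /exp_sum big_ord0; exact: is_derive1_cst.
rewrite (_ : exp_sum n.+2 = fun u : R => exp_sum n.+1 u + n.+1`!%:R^-1 * u ^+ n.+1); last first.
  by apply/funext => u; rewrite [LHS]exp_sumS mulrC.
apply: is_derive_eq (is_derive1D _ _ _ _ _ IHn (is_derive1Z n.+1`!%:R^-1 _ _ _ (is_derive1X n t))) _.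
rewrite exp_sumS factS natrM.
by field; rewrite nat1r !pnatr_eq0 andbT -lt0n fact_gt0.
Qed.

(** A primitive of t^n e^(-t) is -n! E_(n+1)(t) e^(-t), because E_(n+1)' = E_n and E_(n+1) - E_n =
    t^n/n!. *)
Lemma lower_gammaSN n x : 0 < x ->
  lower_gamma n.+1 (- x) = n`!%:R * (1 - expR x * exp_sum n.+1 (- x)).
Proof.
move=> x0; rewrite /lower_gamma oppr_ge0 leNgt x0/=.
pose G t := - (n`!%:R * (exp_sum n.+1 t * expR (- t))).
have dG t : is_derive t 1 G (t ^+ n * expR (- t)).
  have dE := is_derive1_expR_comp _ _ _ (is_derive1N _ _ _ (is_derive1_id t)).
  apply: is_derive_eq (is_derive1N _ _ _ (is_derive1Z n`!%:R _ _ _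
    (is_derive1M _ _ _ _ _ (is_derive_exp_sum n t) dE))) _.
  rewrite exp_sumS; move: (exp_sum _ _) (expR _) => A B.
  by field; rewrite pnatr_eq0 -lt0n fact_gt0.
have cG t : {for t, continuous G} by exact: is_derive1_continuous (dG t).
have cf t : {for t, continuous (fun t : R => t ^+ n * expR (- t))}.
  apply: continuousM; first exact: exprn_continuous.
  apply: (@continuous_comp _ _ _ (fun t => - t) expR); last exact: continuous_expR.
  by apply: continuousN; exact: cvg_id.
rewrite /Rintegral (@continuous_FTC2 R _ G).
- rewrite -EFinB/= /G oppr0 expR0 opprK.
  have -> : exp_sum n.+1 0 = 1 :> R.
    rewrite /exp_sum big_ord_recl expr0 divr1 big1 ?addr0// => i _.
    by rewrite lift0 expr0n mul0r.
  by rewrite (opprK x); ring.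
- by rewrite oppr_lt0.
- by apply: continuous_subspaceT => t; exact: cf.
- split; first by move=> t _; case: (dG t).
  + by apply: cvg_at_right_filter; exact: cG.
  + by apply: cvg_at_left_filter; exact: cG.
- by move=> t _; rewrite derive1E; exact: derive_val.
Qed.

Lemma subexponential_sum p (f : nat -> R -> R) n : (forall i, subexponential p (f i)) ->
  subexponential p (fun t => \sum_(i < n) f i t).
Proof.
move=> sf; elim: n => [|n IHn].
  by apply: eq_subexponential (subexponentialZ p 0 _ (sf 0%N)) => t _; rewrite big_ord0 mul0r.
by apply: eq_subexponential (subexponentialD _ _ _ IHn (sf n)) => t _; rewrite big_ord_recr.
Qed.

Lemma laplace_sum p (f : nat -> R -> R) n x : -1 < p -> 0 < x ->
  (forall i, subexponential p (f i)) ->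
  laplace (fun t => \sum_(i < n) f i t) x = \sum_(i < n) laplace (f i) x.
Proof.
move=> p1 x0 sf; elim: n => [|n IHn].
  rewrite big_ord0 (eq_laplace _ (fun t => 0 * f 0%N t)); last first.
    by move=> t _; rewrite big_ord0 mul0r.
  by rewrite (laplaceZ p)// mul0r.
rewrite big_ord_recr/= -IHn -(laplaceD p)//; last exact: subexponential_sum.
by apply: eq_laplace => t _; rewrite big_ord_recr.
Qed.

Lemma subexponential_powR_nat n : subexponential 0 (@powR R ^~ n%:R).
Proof.
elim: n => [|n IHn]; first exact: subexponential_powR.
apply: eq_subexponential (subexponential_idM _ _ IHn) => t t0.
by rewrite -natr1 powRD1.
Qed.

(** At a = 0 the integrand is the polynomial ((1+t)^m - 1)/t; each t^i of its binomial expansion has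
    transform i! x^(-i-1). *)
Lemma tricomi_remainder0 m x : 0 < x ->
  tricomi_remainder 0 (1 + m%:R) x =
  \sum_(i < m) 'C(m, i.+1)%:R * i`!%:R * x ^- i.+1.
Proof.
move=> x0; rewrite /tricomi_remainder.
rewrite (eq_laplace _ (fun t => \sum_(i < m) 'C(m, i.+1)%:R * t `^ i%:R)); last first.
  move=> t t0.
  rewrite sub0r powR_inv1 ?ltW// (_ : 1 + m%:R - 1 - 0 = m%:R); last by ring.
  rewrite powR_mulrn ?addr_ge0 ?ltW// exprDn big_ord_recl/= subn0 expr1n mulr1 bin0.
  rewrite mulr1n addrC addKr mulr_sumr; apply: eq_bigr => i _.
  rewrite /bump leq0n add1n expr1n mul1r powR_mulrn ?(ltW t0)// exprS -mulr_natl.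
  by rewrite mulrCA mulKf ?gt_eqF.
have sn i : subexponential 0 (fun t : R => 'C(m, i.+1)%:R * t `^ i%:R).
  by apply: subexponentialZ; exact: subexponential_powR_nat.
rewrite (laplace_sum 0 _ _ _ (ltrN10 R) x0 sn).
apply: eq_bigr => i _.
rewrite (laplaceZ 0 _ _ _ (ltrN10 R) (subexponential_powR_nat _) x0).
rewrite laplace_powR//; last by rewrite (lt_le_trans (ltrN10 _)).
by rewrite laplace_powR_nat natr1 powR_invn ?ltW// -mulrA [in RHS](mulrC i`!%:R).
Qed.

End incomplete_gamma.

(** * Reduction of the Whittaker function to the explicit formula *)

Section whittaker.
Context {R : realType}.
Implicit Types (a b z x mu kappa : R) (w : R -> R) (m : nat).

Lemma tricomiUE a b w x : is_tricomiU a b w -> 0 < x -> tricomiU a b x = w x.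
Proof.
move=> sw x0; rewrite /tricomiU; case: xgetP => [y _ [v [sv ->]]|/(_ (w x))[]].
  exact: is_tricomiU_unique sv sw x0.
by exists w.
Qed.

(** The equation follows by substituting Kummer's expression for w''; the asymptotics follow from
    z^(-(a-b+1)) = z^(b-1) z^(-a). *)
Lemma is_tricomiU_kummer_transform a b w : is_tricomiU a b w ->
  is_tricomiU (a - b + 1) (2 - b) (fun z => z `^ (b - 1) * w z).
Proof.
move=> [kw lw]; set s := b - 1; set v := fun z => _.
pose v' z := s * z `^ (s - 1) * w z + z `^ s * derive1 w z.
have dv z : 0 < z -> is_derive z 1 v (v' z).
  move=> z0; have [dw _] := kummer_is_derive _ _ _ _ kw z0.
  exact: is_derive1M (is_derive1_powR s z0) dw.
pose v'' z := s * ((s - 1) * z `^ (s - 1 - 1)) * w z + s * z `^ (s - 1) * derive1 w z +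
  (s * z `^ (s - 1) * derive1 w z + z `^ s * derive1 (derive1 w) z).
have dv' z : 0 < z -> is_derive z 1 v' (v'' z).
  move=> z0; have [dw dw'] := kummer_is_derive _ _ _ _ kw z0.
  exact: is_derive1D (is_derive1M _ _ _ _ _ (is_derive1Z s _ _ _ (is_derive1_powR (s - 1) z0)) dw)
    (is_derive1M _ _ _ _ _ (is_derive1_powR s z0) dw').
have d1E z : 0 < z -> derive1 v z = v' z.
  by move=> /dv d; rewrite derive1E; exact: derive_val.
have d2 z : 0 < z -> is_derive z 1 (derive1 v) (v'' z).
  move=> z0; apply: near_eq_is_derive (dv' _ z0).
  by near=> y; rewrite d1E//; near: y; exact: near_pos.
split=> [z z0|].
  split; [by have [] := dv z z0|by have [] := d2 z z0|].
  rewrite [derive1 (derive1 v) z]derive1E (@derive_val _ _ _ _ _ _ _ (d2 z z0)) d1E//.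
  rewrite /v'' /v' /v (kummer_second_derivative _ _ _ _ kw z0).
  have -> : z `^ s = z * z `^ (s - 1) by rewrite -powRD1// subrK.
  have -> : z `^ (s - 1) = z * z `^ (s - 1 - 1) by rewrite -powRD1// subrK.
  rewrite /s; move: (z `^ _) (w z) (derive1 w z) => P u u'.
  by clear -z0; field; rewrite gt_eqF.
apply: cvg_trans lw; apply: near_eq_cvg; near=> z.
have z0 : 0 < z by near: z; apply: nbhs_pinfty_gt; exact: num_real.
have -> : z `^ (- (a - b + 1)) = z `^ s * z `^ (- a).
  by rewrite -powRD ?(gt_eqF z0) ?implybT//; congr powR; rewrite /s; ring.
rewrite /v -mulf_div divff ?mul1r//.
by rewrite gt_eqF// powR_gt0.
Unshelve. all: by end_near. Qed.

(** For mu = -m/2 the Kummer transformation contributes x^m, which turns the prefactor x^((1-m)/2)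
    into x^((1+m)/2), so both signs give the same expression. *)
Lemma whittakerWE m mu kappa x : 0 < x -> mu = m%:R / 2 \/ mu = - (m%:R / 2) ->
  -1 < (1 + m%:R) / 2 - kappa ->
  laplace (@powR R ^~ ((1 + m%:R) / 2 - kappa)) 1 != 0 ->
  whittakerW kappa mu x = expR (- x / 2) * x `^ ((1 + m%:R) / 2) *
    tricomi_formula ((1 + m%:R) / 2 - kappa) (1 + m%:R) x.
Proof.
move=> x0 hmu a1 G0.
have sw := is_tricomiU_formula _ (1 + m%:R) a1 G0.
rewrite /whittakerW; case: hmu => ->.
  rewrite (_ : 1 / 2 + m%:R / 2 - kappa = (1 + m%:R) / 2 - kappa); last by field.
  rewrite (_ : 1 + 2 * (m%:R / 2) = 1 + m%:R); last by field.
  rewrite (_ : m%:R / 2 + 1 / 2 = (1 + m%:R) / 2); last by field.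
  by rewrite (tricomiUE _ _ _ _ sw x0).
have sv := is_tricomiU_kummer_transform _ _ _ sw.
rewrite (_ : 1 / 2 + - (m%:R / 2) - kappa = (1 + m%:R) / 2 - kappa - (1 + m%:R) + 1);
  last by field.
rewrite (_ : 1 + 2 * (- (m%:R / 2)) = 2 - (1 + m%:R)); last by field.
rewrite (tricomiUE _ _ _ _ sv x0) mulrA; congr (_ * _); rewrite -mulrA; congr (_ * _).
rewrite -powRD ?(gt_eqF x0) ?implybT//; congr powR.
by field.
Qed.

Lemma whittakerW_near m mu x : 0 < x -> mu = m%:R / 2 \/ mu = - (m%:R / 2) ->
  \forall kappa \near ((1 + m%:R) / 2 : R), whittakerW kappa mu x =
    expR (- x / 2) * x `^ ((1 + m%:R) / 2) *
    tricomi_formula ((1 + m%:R) / 2 - kappa) (1 + m%:R) x.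
Proof.
move=> x0 hmu; set c : R := (1 + m%:R) / 2.
have c0 : c - kappa @[kappa --> c] --> (0 : R).
  by rewrite -[X in _ --> X](subrr c); apply: cvgB; [exact: cvg_cst|exact: cvg_id].
have G := c0 _ (@Gamma1D_neq0_near R).
have a1 : \forall kappa \near c, -1 < c - kappa.
  by apply: (cvgr_gt _ c0); exact: ltrN10.
by apply: filterS2 a1 G => kappa a1 G; exact: whittakerWE.
Qed.

End whittaker.

Theorem theorem15 (R : realType) (m : nat) (x : R) (hx : 0 < x)
    (mu : R) (hmu : mu = m%:R / 2 \/ mu = - (m%:R / 2)) :
  is_derive ((1 + m%:R) / 2 : R) (1 : R) (fun kappa : R => whittakerW kappa mu x)
    (expR (- x / 2) * x `^ ((1 + m%:R) / 2) *
     (ln x - \sum_(1 <= k < m.+1)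
        x ^- k * (expR x * Gamma (k%:R : R) +
                  'C(m, k)%:R * lower_gamma k (- x)))).
Proof.
set c : R := (1 + m%:R) / 2.
(* The formula holds only for kappa near c, which suffices for the derivative at c. *)
apply: (@near_eq_is_derive _ _ _ (fun kappa : R => expR (- x / 2) * x `^ c *
    tricomi_formula (c - kappa) (1 + m%:R) x)).
  near=> kappa; apply/esym; near: kappa; exact: whittakerW_near.
have dc := is_derive1B _ _ _ _ _ (is_derive1_cst c c) (is_derive1_id c).
have dU := is_derive_tricomi_order (1 + m%:R) _ hx.
rewrite -[in is_derive 0](subrr c) in dU.
have d := is_derive1Z (expR (- x / 2) * x `^ c) _ _ _
  (@is_derive1_comp R (fun a => tricomi_formula a (1 + m%:R) x) (fun kappa => c - kappa) c _ _
    dU dc).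
apply: is_derive_eq d _; congr (_ * _).
(* The inner derivative of c - kappa is -1, which turns -ln x + H into ln x - H. *)
rewrite sub0r mulrN1 opprD opprK tricomi_remainder0//; congr (_ - _).
rewrite big_add1 /= big_mkord.
under [RHS]eq_bigr do rewrite GammaS lower_gammaSN//.
have x1 : x != 0 by rewrite gt_eqF.
(* Once the incomplete gammas are expanded, the terms carrying e^x cancel by [binomial_exp_sum], and
   what is left is H(0, 1 + m, x). *)
transitivity (\sum_(i < m) 'C(m, i.+1)%:R * i`!%:R * x ^- i.+1 +
  expR x * (\sum_(i < m) i`!%:R * x ^- i.+1 -
    \sum_(i < m) 'C(m, i.+1)%:R * i`!%:R * x ^- i.+1 * exp_sum i.+1 (- x))).
  by rewrite binomial_exp_sum// subrr mulr0 addr0.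
rewrite -sumrB mulr_sumr -big_split/=; apply: eq_bigr => i _.
by move: (x ^- _) (expR x) (exp_sum _ _) (i`!%:R) => X e S f; ring.
Unshelve. all: by end_near. Qed.
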